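(* Let $p$ be a prime with $p\ne 3$. The group $\tilde H_d(\mathsf{M}_n;\mathbb{Z}_p)$ is zero unless $2n-8\le 5d$. Moreover, for each $q\ge 0$, with all homology and chains taken with coefficients in $\mathbb{Z}_p$: (i) $\tilde H_{2q-1}(\mathsf{M}_{5q})$ is generated by (homology classes of) cycles of type $[5,2]^q$ and cycles of type $[3,1]\wedge[5q-3,2q-1]$; (ii) $\tilde H_{2q-1}(\mathsf{M}_{5q+1})$ is generated by cycles of type $[1,0]\wedge[5,2]^q$; (iii) $\tilde H_{2q}(\mathsf{M}_{5q+3})$ is generated by cycles of type $[3,1]\wedge[5,2]^q$; (iv) $\tilde H_{2q}(\mathsf{M}_{5q+4})$ is generated by cycles of type $[1,0]\wedge[3,1]\wedge[5,2]^q$.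
   Context: For a finite set $S$, $\mathsf{M}[S]$ is the matching complex of the complete graph on $S$ (vertices: edges $ab=\{a,b\}$; faces: matchings), and $\mathsf{M}_n=\mathsf{M}[[n]]$, $[n]=\{1,\dots,n\}$. $\tilde C$, $\tilde H$ denote reduced simplicial chains and homology; an oriented simplex is written $e_0\wedge\cdots\wedge e_d$. For chains $c,c'$ supported on matchings of disjoint vertex sets, $c\wedge c'$ is the bilinear extension of $(e_0\wedge\cdots\wedge e_a)\wedge(f_0\wedge\cdots\wedge f_b)=e_0\wedge\cdots\wedge e_a\wedge f_0\wedge\cdots\wedge f_b$. A cycle $z\in\tilde C_{d-1}(\mathsf{M}_n)$ with $d=d_1+\cdots+d_s$ has type $[n_1,d_1]\wedge\cdots\wedge[n_s,d_s]$ if there is a partition $[n]=S_1\cup\cdots\cup S_s$ with $|S_i|=n_i$ and cycles $z_i\in\tilde C_{d_i-1}(\mathsf{M}[S_i])$ with $z=z_1\wedge\cdots\wedge z_s$ ($\tilde C_{-1}$ is spanned by the empty simplex); $[n,d]^q$ denotes $q$ copies of $[n,d]$ joined by $\wedge$ (empty if $q=0$). *)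

(* Defs.v *)
From HB Require Import structures.
From mathcomp Require Import all_boot all_order all_algebra.

Set Implicit Arguments.
Unset Strict Implicit.
Unset Printing Implicit Defensive.

Import GRing.Theory.
Local Open Scope ring_scope.

Section SimplicialHomology.

Variables (F : fieldType) (V : finType).

(* A simplicial complex on the vertex type V is given by its set of faces,
   including the empty face; all chains live in one ambient space, in which a
   set s of vertices is identified with the oriented simplex listing s in the
   order of [enum s]. *)
Definition chain := {ffun {set V} -> F^o}.

Fixpoint inversions (s : seq V) : nat :=
  if s is x :: s' then
    (count (fun y => (enum_rank y < enum_rank x)%N) s' + inversions s')%N
  else 0%N.

(* [osimp [:: e_0; ...; e_d]] is e_0 /\ ... /\ e_d; it changes by the signature
   when the vertices are permuted and vanishes if a vertex is repeated. *)
Definition osimp (s : seq V) : chain :=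
  [ffun t => if uniq s && (t == [set x in s]) then (-1) ^+ inversions s else 0].

Definition wedge (c c' : chain) : chain :=
  \sum_(s : {set V}) \sum_(t : {set V})
    (c s * c' t) *: osimp (enum s ++ enum t).

Definition osimp_boundary (s : seq V) : chain :=
  \sum_(i < size s) (-1) ^+ i *: osimp (take i s ++ drop i.+1 s).

Definition boundary (c : chain) : chain :=
  \sum_(s : {set V}) c s *: osimp_boundary (enum s).

Lemma boundary_is_linear : linear boundary.
Proof.
move=> a c c'; rewrite /boundary scaler_sumr -big_split /=.
by apply: eq_bigr => s _; rewrite !ffunE scalerDl scalerA.
Qed.

HB.instance Definition _ :=
  GRing.isLinear.Build F chain chain *:%R boundary boundary_is_linear.

Variables (K : {set {set V}}) (d : int).

Definition chains (k : int) : {vspace chain} :=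
  span [seq osimp (enum s) | s : {set V} in [set s in K | #|s|%:Z == k + 1]]%R.

Definition cycles : {vspace chain} := (chains d :&: lker (linfun boundary))%VS.

Definition boundaries : {vspace chain} :=
  (linfun boundary @: chains (d + 1))%VS.

Definition boundaries_in_cycles : {vspace subvs_of cycles} :=
  (linfun vsval @^-1: boundaries)%VS.

Definition homology : zmodType :=
  Quotient.quot (pred_of_vspace boundaries_in_cycles).

Definition hclass (z : subvs_of cycles) : homology :=
  (\pi_(Quotient.quot (pred_of_vspace boundaries_in_cycles)) z)%qT.

Definition homology_generated_by (P : chain -> Prop) : Prop :=
  forall x : homology,
    exists2 w : seq (int * subvs_of cycles),
      forall u, u \in w -> P (vsval u.2)
      & x = \sum_(u <- w) hclass u.2 *~ u.1.

End SimplicialHomology.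

Definition matching_complex (T : finType) (S : {set T}) : {set {set {set T}}} :=
  [set m | trivIset m & [forall e in m, (#|e| == 2%N) && (e \subset S)]].

Definition M (n : nat) : {set {set {set 'I_n}}} :=
  matching_complex [set: 'I_n].

(* The list ty of pairs (n_i, d_i) stands for [n_1, d_1] /\ ... /\ [n_s, d_s].
   Its entries are integers, so that expressions such as 5q - 3 are not
   truncated. *)
Definition of_type (F : fieldType) (n : nat) (ty : seq (int * int))
    (c : chain F {set 'I_n}) : Prop :=
  exists (S : 'I_(size ty) -> {set 'I_n})
         (z : 'I_(size ty) -> chain F {set 'I_n}),
    [/\ forall i j, i != j -> [disjoint S i & S j],
        \bigcup_i S i = [set: 'I_n],
        forall i, #|S i|%:Z = (tnth (in_tuple ty) i).1,
        forall i, z i \in cycles F (matching_complex (S i))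
                                   ((tnth (in_tuple ty) i).2 - 1)
      & c = \big[@wedge F _/osimp F [::]]_i z i].

(* Main.v *)
From HB Require Import structures.
Require Import Defs.
From mathcomp Require Import all_boot all_order all_algebra.
From mathcomp Require Import ring zify.

Set Implicit Arguments.
Unset Strict Implicit.
Unset Printing Implicit Defensive.

Import GRing.Theory.
Local Open Scope ring_scope.

(* Fix two vertices a, b of S.  Modulo boundaries and products (as - ab) /\ c and
   (bs - ba) /\ c, with c a cycle on n - 3 vertices, a cycle z of M[S] is determined
   by its coefficients at the faces as /\ bt, which are cycles on n - 4 vertices:
   if these vanish, subtracting such products leaves the boundary of ab /\ z.  A
   leading term as /\ bt /\ c lifts to a cycle when c is a boundary, and also when c
   avoids a further vertex u: complete as /\ bt to a pentagon on a, b, s, t, u.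

   Two relations need 3 to be invertible: [3,1] /\ [3,1] is a combination of cycles
   of type [1,0] /\ [5,2] modulo boundaries, and [1,0] /\ [3,1] /\ [3,1] bounds.
   With these, all statements follow by a simultaneous induction on n: among
   the vanishing groups only 2n = 5k + 4 (k edges per face) is not immediate, and
   there the cycles have type [3,1] /\ [1,0] /\ [3,1] /\ [5,2]^q by (iv). *)

(** * Exterior algebra of chains *)

Section Exterior.

Variables (F : fieldType) (V : finType).
Implicit Types (x y : V) (s t : {set V}) (l : seq V) (c : chain F V).

(** Put δ = 2n - 5k. Multiplying by a fan as - ab leaves a cofactor with δ - 1 (three vertices and
    one edge fewer), a leading term as /\ bt leaves a coefficient with δ + 2, and a block [5,2] does
    not change δ. The groups vanish for δ >= 4, while (i), (iii), (ii), (iv) are the cases δ = 0, 1,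
    2, 3. So each case refers to the one just below through its fans and to δ + 2 through its
    leading terms; at δ = 0 nothing is known about the fan cofactor, whence the unspecified block
    [5q-3, 2q-1] in (i).

    The prime 3 is a genuine obstruction: over the integers the group H_1 of M_7 is cyclic of order
    3.

    All vertex sets are subsets S of one type and all chains live in one space, so deleting vertices
    needs no relabelling. The elimination is stated for any subspace Q containing the boundaries: Q
    is the space of boundaries for vanishing, and the span of boundaries and cycles of a given type
    for generation. *)

Definition tsgn (x y : V) : F := (-1) ^+ (enum_rank x < enum_rank y)%N.

(** The sign that sorts x into t: one factor -1 for each member of t below x. As x itself
    contributes 1, the formula serves both for x in t and for x outside t. *)
Definition psgn x t : F := \prod_(y in t) tsgn y x.

(** Left exterior multiplication by x; [del x] is the dual contraction. Signs of simplices are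
    handled through the anticommutation relations of these operators. *)
Definition ins x c : chain F V :=
  [ffun t : {set V} => if x \in t then psgn x t * c (t :\ x) else 0].

Definition del x c : chain F V :=
  [ffun t : {set V} => if x \notin t then psgn x t * c (x |: t) else 0].

Lemma ins_linear x : linear (ins x).
Proof.
move=> a c c'; apply/ffunP => t; rewrite !ffunE; case: ifP => _.
  by rewrite mulrDr scalerAr.
by rewrite scaler0 addr0.
Qed.

HB.instance Definition _ x :=
  GRing.isLinear.Build F (chain F V) (chain F V) *:%R (ins x) (ins_linear x).

Lemma del_linear x : linear (del x).
Proof.
move=> a c c'; apply/ffunP => t; rewrite !ffunE; case: ifP => _.
  by rewrite mulrDr scalerAr.
by rewrite scaler0 addr0.
Qed.

HB.instance Definition _ x :=
  GRing.isLinear.Build F (chain F V) (chain F V) *:%R (del x) (del_linear x).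

Lemma tsgnxx x : tsgn x x = 1.
Proof. by rewrite /tsgn ltnn. Qed.

Lemma tsgn_sq x y : tsgn x y * tsgn x y = 1.
Proof. by rewrite /tsgn -signr_addb addbb. Qed.

Lemma tsgn_anti x y : x != y -> tsgn x y = - tsgn y x.
Proof.
move=> neq; rewrite /tsgn; case: ltngtP => [||/ord_inj/enum_rank_inj/eqP].
- by rewrite expr0 expr1.
- by rewrite expr0 expr1 opprK.
- by rewrite (negPf neq).
Qed.

Lemma psgn_sq x t : psgn x t * psgn x t = 1.
Proof. by rewrite -big_split big1 //= => y _; rewrite tsgn_sq. Qed.

Lemma psgnU1 x y t : x \notin t -> psgn y (x |: t) = tsgn x y * psgn y t.
Proof. by move=> xt; rewrite /psgn big_setU1. Qed.

Lemma psgnD1 x y t : x \in t -> psgn y t = tsgn x y * psgn y (t :\ x).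
Proof. by move=> xt; rewrite /psgn (big_setD1 x). Qed.

Lemma ins_ins x y c : ins x (ins y c) = - ins y (ins x c).
Proof.
apply/ffunP => t; rewrite !ffunE !inE.
have [->|neq] := eqVneq x y; first by rewrite /= mulr0; case: ifP; rewrite ?oppr0.
case xt: (x \in t); case yt: (y \in t); rewrite /= ?mulr0 ?oppr0 //.
rewrite (@psgnD1 y x t) // (@psgnD1 x y t) // (tsgn_anti neq).
have -> : t :\ y :\ x = t :\ x :\ y by rewrite !setDDl setUC.
by ring.
Qed.

Lemma del_ins x y c : x != y -> del x (ins y c) = - ins y (del x c).
Proof.
move=> neq; apply/ffunP => t; rewrite !ffunE !inE (negPf neq).
rewrite [y == x]eq_sym (negPf neq) /=.
case xt: (x \in t); case yt: (y \in t); rewrite /= ?mulr0 ?oppr0 //.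
rewrite psgnU1 ?xt // (@psgnD1 y x) // (tsgn_anti neq).
have -> : x |: t :\ y = (x |: t) :\ y.
  by rewrite setDUl; congr (_ :|: _); apply/esym/setDidPl; rewrite disjoints1 inE.
by ring: (tsgn_sq y x).
Qed.

(** The two summands are the projections to the faces without x and to the faces with x. *)
Lemma del_insxx x c : del x (ins x c) + ins x (del x c) = c.
Proof.
apply/ffunP => t; rewrite !ffunE !inE eqxx /=.
case xt: (x \in t) => /=.
  rewrite add0r (@psgnD1 x x) // tsgnxx mul1r mulrA psgn_sq mul1r.
  by rewrite setD1K.
by rewrite addr0 psgnU1 ?xt // tsgnxx mul1r mulrA psgn_sq mul1r setU1K ?xt.
Qed.

Lemma del_del x y c : del x (del y c) = - del y (del x c).
Proof.
apply/ffunP => t; rewrite !ffunE !inE.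
have [->|neq] := eqVneq x y; first by rewrite /= mulr0; case: ifP; rewrite ?oppr0.
rewrite /=.
case xt: (x \in t); case yt: (y \in t); rewrite /= ?mulr0 ?oppr0 //.
rewrite psgnU1 ?xt // psgnU1 ?yt // (tsgn_anti neq).
have -> : y |: (x |: t) = x |: (y |: t) by rewrite setUCA.
by ring.
Qed.

Lemma ins_delE x c t : ins x (del x c) t = if x \in t then c t else 0.
Proof.
rewrite !ffunE !inE eqxx /=; case: ifP => // xt.
by rewrite (@psgnD1 x x) // tsgnxx mul1r mulrA psgn_sq mul1r setD1K.
Qed.

(** * Oriented simplices and wedge products through exterior multiplication *)

Definition vac : chain F V := osimp F [::].

Lemma vacE t : vac t = (t == set0)%:R.
Proof. by rewrite ffunE /=; have -> : [set x in [::]] = set0 :> {set V} by [];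
  case: eqP. Qed.

Lemma sign_inversions_cons x l :
  (-1) ^+ inversions (x :: l) = \prod_(y <- l) tsgn y x * (-1) ^+ inversions l :> F.
Proof.
rewrite /= exprD; congr (_ * _).
elim: l => [|y l IH] /=; first by rewrite big_nil.
by rewrite big_cons exprD IH.
Qed.

(** Turns the inversion count into operators: a simplex is a product of exterior multiplications
    applied to the empty simplex, which allows induction on the vertex list. *)
Lemma osimp_cons x l : osimp F (x :: l) = ins x (osimp F l).
Proof.
apply/ffunP => t; rewrite !ffunE [uniq _]/= set_cons.
case xt: (x \in t); last first.
  case: eqP => [et|]; last by rewrite andbF.
  by move: xt; rewrite et !inE eqxx.
case xl: (x \in l) => /=.
  case: (altP (t :\ x =P _)) => [/setP/(_ x)|]; last by rewrite andbF mulr0.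
  by rewrite !inE eqxx xl.
have xl' : x \notin [set y in l] by rewrite inE xl.
have -> : (t == x |: [set y in l]) = (t :\ x == [set y in l]).
  apply/eqP/eqP => [->|<-]; first by rewrite setU1K.
  by rewrite setD1K.
case: ifP => [/andP[ul /eqP et]|]; last by rewrite mulr0.
rewrite sign_inversions_cons; congr (_ * _).
rewrite (@psgnD1 x x) // tsgnxx mul1r et /psgn big_uniq //=.
by apply: eq_bigl => y; rewrite inE.
Qed.

(** [enum s] filters [enum V], along which the ranks are 0, 1, 2, ...; hence the value of a chain at
    s is its coefficient without a sign. *)
Lemma inversions_enum s : inversions (enum s) = 0%N.
Proof.
have: pairwise (fun x y => enum_rank x < enum_rank y)%N (enum s).
  rewrite {1}/(enum _) -enumT; apply: pairwise_filter.
  have -> : pairwise (fun x y : V => enum_rank x < enum_rank y)%N (enum V)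
     = pairwise ltn (map (fun x => val (enum_rank x)) (enum V)).
    by rewrite pairwise_map.
  rewrite -(sorted_pairwise ltn_trans).
  suff -> : [seq val (enum_rank x) | x <- enum V] = iota 0 #|V| by exact: iota_ltn_sorted.
  apply: (@eq_from_nth _ 0%N); first by rewrite size_map size_iota -cardE.
  move=> i; rewrite size_map => lt_i.
  have x0 : V by case: (enum V) lt_i.
  have lt_i' : (i < #|V|)%N by rewrite cardE.
  rewrite (nth_map x0) // nth_iota // add0n.
  have /= <- := @enum_val_nth V predT x0 (Ordinal lt_i').
  by rewrite enum_valK.
elim: (enum s) => //= x l IH /andP[/allP lt_x /IH ->]; rewrite addn0.
rewrite (@eq_in_count _ _ pred0) ?count_pred0 // => y /lt_x lt_xy /=.
by apply/negbTE; rewrite -leqNgt ltnW.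
Qed.

Lemma osimp_enumE s t : osimp F (enum s) t = (t == s)%:R.
Proof. by rewrite ffunE enum_uniq inversions_enum set_enum expr0 /=; case: eqP. Qed.

Lemma chain_decomp c : c = \sum_s c s *: osimp F (enum s).
Proof.
apply/ffunP => t; rewrite sum_ffunE (bigD1 t) //= big1 => [|s neq].
  by rewrite addr0 ffunE osimp_enumE eqxx [RHS]mulr1.
by rewrite ffunE osimp_enumE eq_sym (negPf neq) scaler0.
Qed.

Definition insl l c : chain F V := foldr ins c l.

Lemma insl_linear l : linear (insl l).
Proof. by move=> a c c'; elim: l => //= x l ->; rewrite linearP. Qed.

HB.instance Definition _ l :=
  GRing.isLinear.Build F (chain F V) (chain F V) *:%R (insl l) (insl_linear l).

Lemma osimpE l : osimp F l = insl l vac.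
Proof. by elim: l => //= x l <-; rewrite osimp_cons. Qed.

Lemma insl_cat l1 l2 c : insl (l1 ++ l2) c = insl l1 (insl l2 c).
Proof. exact: foldr_cat. Qed.

(* The sign that sorts [l] and then moves it past the rest of the face. *)
Lemma inslE l c t :
  insl l c t = if uniq l && ([set x in l] \subset t) then
    (-1) ^+ inversions l * \prod_(x <- l) psgn x (t :\: [set y in l])
      * c (t :\: [set x in l])
  else 0.
Proof.
elim: l t => [|x l IH] t; first by rewrite big_nil /= sub0set setD0 expr0 !mul1r.
rewrite [insl _ _]/= ffunE IH sign_inversions_cons big_cons set_cons [uniq _]/=.
rewrite subUset sub1set.
case xt: (x \in t); last by rewrite andbF.
case xl: (x \in l) => /=.
  by rewrite subsetD1 inE xl /= !andbF mulr0.
rewrite subsetD1 inE xl /= andbT; case: ifP; last by rewrite mulr0.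
move=> /andP[ul st].
rewrite setDDl !mulrA; congr (_ * _ * _); rewrite [RHS]mulrAC; congr (_ * _).
rewrite /psgn (big_setID [set y in l]) /=.
rewrite (setIidPr st); congr (_ * _).
  by rewrite big_uniq //=; apply: eq_bigl => y; rewrite inE.
rewrite (big_setD1 x) ?inE ?xl ?xt //= tsgnxx mul1r.
by apply: eq_bigl => y; rewrite !inE; case: (y == x); rewrite ?andbF.
Qed.

Lemma insl_enum l c : uniq l ->
  insl l c = (-1) ^+ inversions l *: insl (enum [set x in l]) c.
Proof.
move=> ul; apply/ffunP => t; rewrite ffunE !inslE ul enum_uniq set_enum inversions_enum.
rewrite expr0 mul1r; case: ifP => _; last by rewrite /= scaler0.
rewrite /= [RHS]mulrA; congr (_ * _ * _); apply: perm_big.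
by apply: uniq_perm => // [|x]; rewrite ?enum_uniq // mem_enum inE.
Qed.

Lemma wedgeE c c' : wedge c c' = \sum_s c s *: insl (enum s) c'.
Proof.
apply: eq_bigr => s _; rewrite {2}(chain_decomp c') linear_sum /= scaler_sumr.
by apply: eq_bigr => t _; rewrite linearZ /= scalerA !osimpE insl_cat.
Qed.

Lemma wedgeDZl a c1 c2 c : wedge (a *: c1 + c2) c = a *: wedge c1 c + wedge c2 c.
Proof.
rewrite !wedgeE scaler_sumr -big_split; apply: eq_bigr => s _ /=.
by rewrite !ffunE scalerDl scalerA.
Qed.

Lemma wedge_linear c : linear (wedge c).
Proof.
move=> a c1 c2; rewrite !wedgeE scaler_sumr -big_split; apply: eq_bigr => s _ /=.
by rewrite linearP scalerDr !scalerA mulrC.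
Qed.

HB.instance Definition _ c :=
  GRing.isLinear.Build F (chain F V) (chain F V) *:%R (wedge c) (wedge_linear c).

Definition wedger c' c : chain F V := wedge c c'.

Lemma wedger_linear c' : linear (wedger c').
Proof. by move=> a c1 c2; exact: wedgeDZl. Qed.

HB.instance Definition _ c' :=
  GRing.isLinear.Build F (chain F V) (chain F V) *:%R (wedger c') (wedger_linear c').

Lemma wedge0l c : wedge 0 c = 0.
Proof. exact: (linear0 (wedger c)). Qed.

Lemma wedgeBl c1 c2 c : wedge (c1 - c2) c = wedge c1 c - wedge c2 c.
Proof. exact: (linearB (wedger c)). Qed.

Lemma wedgeDl c1 c2 c : wedge (c1 + c2) c = wedge c1 c + wedge c2 c.
Proof. exact: (linearD (wedger c)). Qed.

Lemma wedgeZl a c1 c : wedge (a *: c1) c = a *: wedge c1 c.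
Proof. exact: (linearZ_LR (wedger c)). Qed.

Lemma wedge_osimp l c : wedge (osimp F l) c = insl l c.
Proof.
rewrite wedgeE.
have [ul|nul] := boolP (uniq l); last first.
  rewrite big1 => [|s _]; last by rewrite ffunE (negPf nul) scale0r.
  by apply/ffunP => t; rewrite inslE (negPf nul) ffunE.
rewrite insl_enum // (bigD1 [set x in l]) //= big1 => [|s neq].
  by rewrite ffunE ul eqxx addr0.
by rewrite ffunE (negPf neq) andbF scale0r.
Qed.

Lemma wedge_vac c : wedge vac c = c.
Proof. by rewrite /vac wedge_osimp. Qed.

(** The hypothesis ranges over all lists, not only sorted ones, so that it can be proved by
    induction on the list. *)
Lemma chain_ext (f g : {linear chain F V -> chain F V}) :
  (forall l, f (osimp F l) = g (osimp F l)) -> f =1 g.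
Proof.
move=> fg c; rewrite (chain_decomp c) !linear_sum; apply: eq_bigr => s _.
by rewrite !linearZ /= fg.
Qed.

Lemma wedge_ins x c c' : wedge (ins x c) c' = ins x (wedge c c').
Proof.
apply: (chain_ext (f := wedger c' \o ins x) (g := ins x \o wedger c')) => l.
by rewrite /= -osimp_cons /wedger !wedge_osimp.
Qed.

Lemma wedgeA c1 c2 c3 : wedge c1 (wedge c2 c3) = wedge (wedge c1 c2) c3.
Proof.
apply: (chain_ext (f := wedger (wedge c2 c3)) (g := wedger c3 \o wedger c2)) => l.
rewrite /= /wedger !wedge_osimp.
by elim: l => //= x l ->; rewrite wedge_ins.
Qed.

Lemma wedge_vacr c : wedge c vac = c.
Proof.
apply: (chain_ext (f := wedger vac) (g := idfun)) => l.
by rewrite [LHS]wedge_osimp osimpE.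
Qed.

(** * The boundary as a sum of contractions; Leibniz rule and graded commutativity *)

Lemma osimp_boundary_cons x l :
  osimp_boundary F (x :: l) = osimp F l - ins x (osimp_boundary F l).
Proof.
rewrite /osimp_boundary /= big_ord_recl /= expr0 scale1r drop0; congr (_ + _).
rewrite linear_sum -sumrN; apply: eq_bigr => i _.
by rewrite linearZ /= -osimp_cons exprS mulN1r scaleNr.
Qed.

Lemma sum_del_ins x c : \sum_y del y (ins x c) = c - ins x (\sum_y del y c).
Proof.
rewrite (bigD1 x) //= [X in _ - ins _ X](bigD1 x) //= linearD /= opprD addrA.
have -> : del x (ins x c) = c - ins x (del x c).
  by apply/esym/eqP; rewrite subr_eq del_insxx.
congr (_ + _).
rewrite linear_sum -sumrN; apply: eq_bigr => y neq.
by rewrite del_ins.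
Qed.

Lemma boundaryE c : boundary c = \sum_x del x c.
Proof.
(* Both sides satisfy the same recursion on the list: adding x in front sends c to c minus x wedge
   its boundary. *)
have del_osimp l : \sum_x del x (osimp F l) = osimp_boundary F l.
  elim: l => [|x l IH]; last by rewrite osimp_boundary_cons osimp_cons sum_del_ins IH.
  rewrite /osimp_boundary big_ord0 big1 // => x _; apply/ffunP => t.
  rewrite -/vac ffunE vacE [RHS]ffunE; case: ifP => // _.
  by case: eqP => [/setP/(_ x)|]; rewrite ?mulr0 // !inE eqxx.
rewrite /boundary; under eq_bigr => s _ do rewrite -del_osimp scaler_sumr.
rewrite exchange_big /=; apply: eq_bigr => x _.
rewrite {2}[c]chain_decomp linear_sum /=.
by apply: eq_bigr => s _; rewrite linearZ.
Qed.

Lemma boundary_vac : boundary vac = 0.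
Proof.
rewrite boundaryE big1 // => x _; apply/ffunP => t; rewrite ffunE vacE [RHS]ffunE.
by case: ifP => // _; case: eqP => [/setP/(_ x)|]; rewrite ?mulr0 // !inE eqxx.
Qed.

(** The cone formula: for a cycle c it gives c as the boundary of x wedge c. *)
Lemma boundary_ins x c : boundary (ins x c) = c - ins x (boundary c).
Proof. by rewrite !boundaryE sum_del_ins. Qed.

Lemma boundary_del x c : boundary (del x c) = - del x (boundary c).
Proof.
rewrite !boundaryE linear_sum -sumrN; apply: eq_bigr => y _.
exact: del_del.
Qed.

Lemma boundaryK c : boundary (boundary c) = 0.
Proof.
pose f := [the {linear chain F V -> chain F V} of @boundary F V \o @boundary F V].
rewrite -[LHS]/(f c) (chain_decomp c) linear_sum big1 // => s _; rewrite linearZ /=.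
suff -> : boundary (boundary (osimp F (enum s))) = 0 by rewrite scaler0.
rewrite osimpE; elim: (enum s) => [|x l IH] /=; first by rewrite boundary_vac linear0.
by rewrite -/(insl l vac) boundary_ins linearB /= boundary_ins IH linear0 subr0 subrr.
Qed.

Definition homogeneous k c := forall t, c t != 0 -> #|t| = k.

Lemma homogeneous_ind k (f g : {linear chain F V -> chain F V}) :
  (forall l, size l = k -> f (osimp F l) = g (osimp F l)) ->
  forall c, homogeneous k c -> f c = g c.
Proof.
move=> fg c hc; rewrite (chain_decomp c) !linear_sum; apply: eq_bigr => s _.
rewrite !linearZ /=; have [->|nz] := eqVneq (c s) 0; first by rewrite !scale0r.
by rewrite fg // -cardE hc.
Qed.

Lemma boundary_wedge_osimp l c :
  boundary (wedge (osimp F l) c) =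
    wedge (boundary (osimp F l)) c + (-1) ^+ size l *: wedge (osimp F l) (boundary c).
Proof.
elim: l => [|x l IH].
  by rewrite !wedge_vac boundary_vac expr0 scale1r wedge0l add0r.
rewrite osimp_cons !wedge_ins !boundary_ins IH wedgeBl.
rewrite wedge_ins [ins x (_ + _)]linearD linearZ /= exprS mulN1r scaleNr.
by rewrite opprD addrA.
Qed.

Lemma boundary_wedge k c c' : homogeneous k c ->
  boundary (wedge c c') = wedge (boundary c) c' + (-1) ^+ k *: wedge c (boundary c').
Proof.
apply: (homogeneous_ind (f := @boundary F V \o wedger c')
  (g := (wedger c' \o @boundary F V) \+ ((-1) ^+ k \*: wedger (boundary c')))) => l <-.
exact: boundary_wedge_osimp.
Qed.

Lemma osimp_catC l l' :
  osimp F (l ++ l') = (-1) ^+ (size l * size l') *: osimp F (l' ++ l).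
Proof.
elim: l => [|x l IH]; first by rewrite mul0n expr0 scale1r cats0.
rewrite cat_cons osimp_cons IH linearZ /= mulSn exprD mulrC -scalerA; congr (_ *: _).
elim: l' {IH} => [|y l' IH]; first by rewrite expr0 scale1r osimp_cons.
rewrite !cat_cons !osimp_cons ins_ins IH linearZ /= exprS mulN1r scaleNr.
by [].
Qed.

Lemma wedgeC k k' c c' : homogeneous k c -> homogeneous k' c' ->
  wedge c c' = (-1) ^+ (k * k') *: wedge c' c.
Proof.
move=> hc hc'; move: c hc; apply: (homogeneous_ind (f := wedger c')
  (g := (-1) ^+ (k * k') \*: wedge c')) => l <-.
move: c' hc'; apply: (homogeneous_ind (f := wedge (osimp F l))
  (g := (-1) ^+ (size l * k') \*: wedger (osimp F l))) => l' <-.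
by rewrite /= /wedger !wedge_osimp !osimpE -!insl_cat -!osimpE osimp_catC.
Qed.

End Exterior.

(** * Cycles of matching complexes *)

Section Subspaces.

Variables (F : fieldType) (W : lmodType F).
Implicit Types (P Q : W -> Prop) (x y : W).

(** A [Prop] predicate, since later instances are existential statements such as liftability of a
    leading term. *)
Definition subspace Q := Q 0 /\ forall a x y, Q x -> Q y -> Q (a *: x + y).

Lemma subspaceZ Q a x : subspace Q -> Q x -> Q (a *: x).
Proof. by move=> [Q0 QP] Qx; rewrite -[_ *: _]addr0; exact: QP. Qed.

Lemma subspaceD Q x y : subspace Q -> Q x -> Q y -> Q (x + y).
Proof. by move=> [Q0 QP] Qx Qy; rewrite -[x]scale1r; exact: QP. Qed.

Lemma subspaceN Q x : subspace Q -> Q x -> Q (- x).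
Proof. by move=> sQ Qx; rewrite -scaleN1r; exact: subspaceZ. Qed.

Lemma subspaceB Q x y : subspace Q -> Q x -> Q y -> Q (x - y).
Proof. by move=> sQ Qx Qy; apply: subspaceD => //; exact: subspaceN. Qed.

Lemma subspace_sum Q (I : Type) (r : seq I) (p : pred I) (f : I -> W) :
  subspace Q -> (forall i, p i -> Q (f i)) -> Q (\sum_(i <- r | p i) f i).
Proof.
move=> sQ Qf; apply: (big_ind Q) => // [|x y]; first exact: sQ.1.
exact: subspaceD.
Qed.

(** The intersection of all subspaces containing P, so that induction over generators is its
    definition. *)
Definition lspan P x := forall Q, subspace Q -> (forall y, P y -> Q y) -> Q x.

Lemma lspan_subspace P : subspace (lspan P).
Proof.
split=> [Q sQ _|a x y Px Py Q sQ PQ]; first exact: sQ.1.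
by apply: sQ.2; [exact: Px | exact: Py].
Qed.

Lemma mem_lspan P x : P x -> lspan P x.
Proof. by move=> Px Q _; exact. Qed.

End Subspaces.

(** * Chains, cycles and boundaries supported on matchings of S *)

Section Matchings.

Variables (F : fieldType) (T : finType).
Implicit Types (a b s t u : T) (e : {set T}) (S : {set T}) (m : {set {set T}}).
Implicit Types (c x y z : chain F {set T}) (k : nat).

Lemma matchingP S m :
  reflect ((forall e e', e \in m -> e' \in m -> e != e' -> [disjoint e & e']) /\
           (forall e, e \in m -> #|e| = 2%N /\ e \subset S))
          (m \in matching_complex S).
Proof.
rewrite inE; apply: (iffP andP) => [[/trivIsetP tm /forall_inP em]|[tm em]].
  by split=> // e /em /andP[/eqP].
split; first exact/trivIsetP.
by apply/forall_inP => e /em[-> ->].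
Qed.

Lemma matching_disjoint S m e e' v : m \in matching_complex S ->
  e \in m -> e' \in m -> v \in e -> v \in e' -> e = e'.
Proof.
move=> /matchingP[tm _] em e'm ve ve'; apply/eqP; apply: contraTT isT => neq.
by have := disjointFr (tm _ _ em e'm neq) ve; rewrite ve'.
Qed.

Lemma matching_sub S S' m m' : S \subset S' -> m' \subset m ->
  m \in matching_complex S -> m' \in matching_complex S'.
Proof.
move=> sSS' smm' /matchingP[tm em]; apply/matchingP; split=> [e e' em' e'm'|e em'].
  by apply: tm; exact: (subsetP smm').
by have [-> eS] := em _ (subsetP smm' _ em'); split => //; exact: subset_trans eS _.
Qed.

Lemma matchingU S S' m m' : [disjoint S & S'] ->
  m \in matching_complex S -> m' \in matching_complex S' ->
  m :|: m' \in matching_complex (S :|: S').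
Proof.
move=> dS /matchingP[tm em] /matchingP[tm' em']; apply/matchingP; split=> [e e'|e].
  rewrite !inE => /orP[em1|em1] /orP[em2|em2] neq; [exact: tm| | |exact: tm'].
    by apply: disjointWl (em _ em1).2 _; apply: disjointWr (em' _ em2).2 _.
  rewrite disjoint_sym.
  by apply: disjointWl (em _ em2).2 _; apply: disjointWr (em' _ em1).2 _.
rewrite inE => /orP[/em|/em'] [-> se]; split => //; apply: subset_trans se _.
  exact: subsetUl.
exact: subsetUr.
Qed.

Lemma matching1 e : #|e| = 2%N -> [set e] \in matching_complex e.
Proof.
move=> e2; apply/matchingP; split=> [e1 e' /set1P-> /set1P->|e' /set1P-> //].
by rewrite eqxx.
Qed.

Lemma matchingD1 S m e : m \in matching_complex S -> e \in m ->
  m :\ e \in matching_complex (S :\: e).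
Proof.
move=> /matchingP[tm em] e_m; apply/matchingP; split=> [e1 e2|e1].
  by rewrite !inE => /andP[_ em1] /andP[_ em2]; exact: tm.
rewrite !inE => /andP[neq e1m]; have [-> sS] := em _ e1m; split => //.
by rewrite subsetD sS; exact: tm.
Qed.

(** Here k counts edges, so the dimension is k - 1; the empty simplex has k = 0. *)
Definition matching_chain S k c :=
  forall m, c m != 0 -> m \in matching_complex S /\ #|m| = k.

Lemma matching_chain_subspace S k : subspace (matching_chain S k).
Proof.
split=> [m|a x y Cx Cy m]; rewrite !ffunE ?eqxx //.
have [->|nz _] := eqVneq (x m) 0; last exact: Cx.
by rewrite scaler0 add0r; exact: Cy.
Qed.

Lemma matching_chain_sub S S' k c : S \subset S' ->
  matching_chain S k c -> matching_chain S' k c.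
Proof. by move=> sS Cc m /Cc[mS ->]; split=> //; exact: matching_sub mS. Qed.

Lemma matching_chain_homogeneous S k c : matching_chain S k c -> homogeneous k c.
Proof. by move=> Cc m /Cc[]. Qed.

Lemma matching_chain_out S k c m : matching_chain S k c ->
  m \notin matching_complex S -> c m = 0.
Proof. by move=> Cc mS; apply: contraNeq mS => /Cc[]. Qed.

Lemma matching_chain_ins S k e c : #|e| = 2%N -> [disjoint e & S] ->
  matching_chain S k c -> matching_chain (e :|: S) k.+1 (ins e c).
Proof.
move=> e2 deS Cc m; rewrite ffunE; case: ifP => [em|_]; last by rewrite eqxx.
rewrite mulf_eq0 negb_or => /andP[_ /Cc[mS mk]].
by rewrite (cardsD1 e) em mk -(setD1K em) matchingU ?matching1.
Qed.

(** The link of an edge e in M[S] is M[S \ e]. *)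
Lemma matching_chain_del S k e c : matching_chain S k.+1 c ->
  matching_chain (S :\: e) k (del e c).
Proof.
move=> Cc m; rewrite ffunE; case: ifP => [em|_]; last by rewrite eqxx.
rewrite mulf_eq0 negb_or => /andP[_ /Cc[mS]]; rewrite cardsU1 em => -[mk].
by rewrite -(setU1K em) matchingD1 ?setU11 // setU1K.
Qed.

Lemma matching_chain0E S c : matching_chain S 0 c -> c = c set0 *: vac F _.
Proof.
move=> Cc; apply/ffunP => m; rewrite ffunE vacE.
have [->|neq] := eqVneq m set0; first by rewrite [RHS]mulr1.
rewrite [RHS]mulr0; apply: contraNeq neq => /Cc[_ /eqP].
by rewrite cards_eq0.
Qed.

Lemma matching_chain_vac S : matching_chain S 0 (vac F _).
Proof.
move=> m; rewrite vacE; have [-> _|_] := eqVneq m set0; last by rewrite eqxx.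
by rewrite cards0; split=> //; apply/matchingP; split=> [e e'|e]; rewrite inE.
Qed.

Lemma matching_chain_boundary S k c : matching_chain S k.+1 c ->
  matching_chain S k (boundary c).
Proof.
move=> Cc; rewrite boundaryE; apply: subspace_sum => [|e _].
  exact: matching_chain_subspace.
by apply: matching_chain_sub (matching_chain_del Cc); exact: subsetDl.
Qed.

Lemma matching_chain_wedge S S' k k' c c' : [disjoint S & S'] ->
  matching_chain S k c -> matching_chain S' k' c' ->
  matching_chain (S :|: S') (k + k') (wedge c c').
Proof.
move=> dS Cc Cc'; rewrite wedgeE; apply: subspace_sum => [|m _].
  exact: matching_chain_subspace.
have [->|/Cc[mS mk]] := eqVneq (c m) 0.
  by rewrite scale0r; case: (matching_chain_subspace (S :|: S') (k + k')).
apply: (subspaceZ _ (matching_chain_subspace _ _)).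
move=> n; rewrite inslE set_enum; case: ifP => [/andP[_ smn]|]; last by rewrite eqxx.
rewrite mulf_eq0 negb_or => /andP[_ /Cc'[nS nk]].
split; first by rewrite -(setID n m) (setIidPr smn) matchingU.
by rewrite -mk -nk -[LHS](cardsID m n) (setIidPr smn).
Qed.

Definition cycle_in S k c := matching_chain S k c /\ boundary c = 0.

Definition boundary_in S k c := exists2 b, matching_chain S k.+1 b & c = boundary b.

Lemma cycle_in_subspace S k : subspace (cycle_in S k).
Proof.
split=> [|a x y [Cx dx] [Cy dy]].
  by split; [case: (matching_chain_subspace S k) | rewrite linear0].
split; first exact: (matching_chain_subspace S k).2.
by rewrite linearP /= dx dy scaler0 addr0.
Qed.

Lemma boundary_in_subspace S k : subspace (boundary_in S k).
Proof.
split=> [|a x y [b Cb ->] [b' Cb' ->]].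
  by exists 0; [case: (matching_chain_subspace S k.+1) | rewrite linear0].
exists (a *: b + b'); last by rewrite linearP.
exact: (matching_chain_subspace S k.+1).2.
Qed.

Lemma boundary_in_cycle S k c : boundary_in S k c -> cycle_in S k c.
Proof.
by case=> b Cb ->; split; [exact: matching_chain_boundary | exact: boundaryK].
Qed.

Lemma boundary_in_sub S S' k c : S \subset S' -> boundary_in S k c -> boundary_in S' k c.
Proof. by move=> sS [b Cb ->]; exists b => //; exact: matching_chain_sub Cb. Qed.

Lemma cycle_in_vac S : cycle_in S 0 (vac F _).
Proof. by split; [exact: matching_chain_vac | exact: boundary_vac]. Qed.

Lemma cycle_in_del S k e c : cycle_in S k.+1 c -> cycle_in (S :\: e) k (del e c).
Proof.
move=> [Cc dc]; split; first exact: matching_chain_del.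
by rewrite boundary_del dc linear0 oppr0.
Qed.

Lemma cycle_in_wedge S S' k k' c c' : [disjoint S & S'] ->
  cycle_in S k c -> cycle_in S' k' c' -> cycle_in (S :|: S') (k + k') (wedge c c').
Proof.
move=> dS [Cc dc] [Cc' dc']; split; first exact: matching_chain_wedge.
rewrite (boundary_wedge _ (matching_chain_homogeneous Cc)) dc dc'.
by rewrite wedge0l linear0 scaler0 addr0.
Qed.

(** Leibniz rule; with its mirror image it makes the product of cycles well defined modulo
    boundaries. *)
Lemma boundary_in_wedgel S S' k k' c c' : [disjoint S & S'] ->
  boundary_in S k c -> cycle_in S' k' c' -> boundary_in (S :|: S') (k + k') (wedge c c').
Proof.
move=> dS [b Cb ->] [Cc' dc']; exists (wedge b c').
  by rewrite -addSn; exact: matching_chain_wedge.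
rewrite (boundary_wedge _ (matching_chain_homogeneous Cb)) dc'.
by rewrite linear0 scaler0 addr0.
Qed.

Lemma boundary_in_wedger S S' k k' c c' : [disjoint S & S'] ->
  cycle_in S k c -> boundary_in S' k' c' -> boundary_in (S :|: S') (k + k') (wedge c c').
Proof.
move=> dS [Cc dc] [b Cb ->]; exists ((-1) ^+ k *: wedge c b).
  by rewrite -addnS; apply: (subspaceZ _ (matching_chain_subspace _ _));
    exact: matching_chain_wedge.
rewrite linearZ /= (boundary_wedge _ (matching_chain_homogeneous Cc)) dc.
by rewrite wedge0l add0r scalerA -expr2 sqrr_sign scale1r.
Qed.

End Matchings.

(** * Elimination of two vertices *)

Section Elimination.

Variables (F : fieldType) (T : finType).
Implicit Types (a b s t u : T) (e : {set T}) (S : {set T}) (m : {set {set T}}).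
Implicit Types (c x y z : chain F {set T}) (k : nat).

Lemma matching_edge S m e a : m \in matching_complex S -> e \in m -> a \in e ->
  exists2 s, e = [set a; s] & s \in S :\ a.
Proof.
move=> /matchingP[_ em] /em[/eqP e2 eS] ae.
move: e2; rewrite (cardsD1 a) ae eqSS => /cards1P[s es]; exists s.
  by rewrite -es setD1K.
have: s \in e :\ a by rewrite es inE.
by rewrite !inE => /andP[-> /(subsetP eS)].
Qed.

Lemma edgeIr a s s' : [set a; s] = [set a; s'] -> s = s'.
Proof.
move=> /setP eq; have := eq s; have := eq s'; rewrite !inE !eqxx !orbT.
case: (eqVneq s' a) => [->|_] /=; first by case: eqVneq => //= [-> //|_ _]; case: eqVneq.
by move=> /eqP.
Qed.

Lemma disjoint_edge a s S : a \notin S -> s \notin S -> [disjoint [set a; s] & S].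
Proof.
move=> aS sS; rewrite -setI_eq0; apply/eqP/setP => v; rewrite !inE.
by apply/negP => /andP[/orP[/eqP->|/eqP->]]; rewrite ?(negPf aS) ?(negPf sS).
Qed.

Lemma matching_chain_ins_edge S S' k a s c : a != s -> a \in S -> s \in S ->
  S' \subset S :\: [set a; s] ->
  matching_chain S' k c -> matching_chain S k.+1 (ins [set a; s] c).
Proof.
move=> neq aS sS sS' Cc.
have sub : [set a; s] :|: S' \subset S.
  rewrite subUset; apply/andP; split; last exact: subset_trans sS' (subsetDl _ _).
  by apply/subsetP => v; rewrite !inE => /orP[/eqP->|/eqP->].
apply: matching_chain_sub sub _; apply: matching_chain_ins => //.
  by rewrite cards2 neq.
by rewrite disjoint_sym; move: sS'; rewrite subsetD => /andP[].
Qed.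

Lemma matching_chain_restrict S k b c : matching_chain S k c ->
  (forall m e, c m != 0 -> e \in m -> b \notin e) -> matching_chain (S :\ b) k c.
Proof.
move=> Cc nb m cm; have [/matchingP[tm em] mk] := Cc m cm.
split=> //; apply/matchingP; split=> // e e_m.
by have [-> eS] := em e e_m; rewrite subsetD1 eS (nb m).
Qed.

(** Both cones over the cycle c have boundary c, so their difference is closed. It equals (as - ab)
    /\ c, a product with a cycle on the three vertices a, b, s. *)
Lemma fan_cycle S S' k a b s c : a \in S -> b \in S -> s \in S ->
  a != b -> a != s -> S' = S :\: [set a; b; s] ->
  cycle_in S' k c -> cycle_in S k.+1 (ins [set a; s] c - ins [set a; b] c).
Proof.
move=> aS bS sS nab nas -> [Cc dc]; split.
  apply: (subspaceB (matching_chain_subspace _ _ _)).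
    apply: matching_chain_ins_edge Cc => //; apply: setDS.
    by apply/subsetP => v; rewrite !inE => /orP[]->; rewrite ?orbT.
  apply: matching_chain_ins_edge Cc => //; apply: setDS.
  by apply/subsetP => v; rewrite !inE => /orP[]->; rewrite ?orbT.
by rewrite linearB /= !boundary_ins dc !linear0 ?subr0 ?addr0 subrr.
Qed.

Section Step.

Variables (S : {set T}) (k : nat) (Q : chain F {set T} -> Prop).
Hypothesis sQ : subspace Q.
Hypothesis Q_boundary : forall c, boundary_in S k c -> Q c.
Hypothesis Q_fan : forall k' a b s c, k = k'.+1 ->
  a \in S -> b \in S -> s \in S -> a != b -> a != s -> b != s ->
  cycle_in (S :\: [set a; b; s]) k' c ->
  Q (ins [set a; s] c - ins [set a; b] c).

(* Subtracting the fans spanned at [a] removes every edge at [a] except [ab]. *)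
Lemma strip_vertex a b z : a \in S -> b \in S -> a != b -> cycle_in S k z ->
  (forall m s t, z m != 0 -> s \notin [set a; b] -> t \notin [set a; b] ->
     [set a; s] \in m -> [set b; t] \notin m) ->
  exists z', [/\ cycle_in S k z', Q (z - z'),
    forall m s, z' m != 0 -> [set a; s] \in m -> s = b
    & forall m, z' m != 0 -> [set a; b] \notin m -> z m != 0].
Proof.
move=> aS bS nab zZ nolead.
have [k0|[k' kE]] : k = 0%N \/ exists k', k = k'.+1 by case: (k) => [|k']; [left | right;
  exists k'].
  exists z; split=> //; first by rewrite subrr; case: sQ.
  by move=> m s /zZ.1[_]; rewrite k0 => /eqP; rewrite cards_eq0 => /eqP->; rewrite inE.
pose fan s := ins [set a; s] (del [set a; s] z) - ins [set a; b] (del [set a; s] z).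
pose good s := s \in S :\: [set a; b].
(* In a face of z containing as, the vertex b is unmatched: a partner t would make the face a
   leading one. So the coefficient of as avoids b, and the fan over it is a cycle. *)
have delZ s : good s -> cycle_in (S :\: [set a; b; s]) k' (del [set a; s] z).
  rewrite /good !inE negb_or -andbA => /and3P[nsa nsb sS].
  have [Cd dd] : cycle_in (S :\: [set a; s]) k' (del [set a; s] z).
    by apply: cycle_in_del; rewrite -kE.
  split=> //; have -> : S :\: [set a; b; s] = S :\: [set a; s] :\ b.
    by apply/setP => v; rewrite !inE; do 4!case: eqP => //=.
  apply: matching_chain_restrict Cd _ => m e; rewrite ffunE.
  case: ifP => [asm|_]; last by rewrite eqxx.
  rewrite mulf_eq0 negb_or => /andP[_ zm] em; apply/negP => be.
  have em' : e \in [set a; s] |: m by rewrite inE em orbT.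
  have mS := (zZ.1 _ zm).1.
  have neq : e != [set a; s] by apply: contraNneq asm => <-.
  have [t et _] := matching_edge mS em' be.
  have ne v : v \in [set a; s] -> v \notin e.
    move=> vas; apply: contra neq => ve; apply/eqP.
    by apply: (matching_disjoint mS em' _ ve vas); rewrite inE set11.
  have := nolead _ s t zm; rewrite -et em' setU11 !inE negb_or nsa nsb /=.
  suff -> : (t == a) || (t == b) = false by move=> /(_ isT isT isT).
  apply/negP => /orP[/eqP ta|/eqP tb].
    by have := ne a; rewrite et ta !inE !eqxx orbT => /(_ isT).
  have := ((matchingP _ _ mS).2 _ em').1.
  by rewrite et tb setUid cards1.
have fanZ s : good s -> cycle_in S k (fan s).
  move=> gs; have := gs; rewrite /good !inE negb_or -andbA => /and3P[nsa nsb sS].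
  by rewrite kE; apply: fan_cycle (delZ s gs); rewrite // eq_sym.
have z'Z : cycle_in S k (z - \sum_(s | good s) fan s).
  apply: (subspaceB (cycle_in_subspace _ _ _)) => //.
  by apply: (subspace_sum _ (cycle_in_subspace _ _ _)).
(* On faces without ab the second half of a fan vanishes, and the first half is the part of z
   containing as. As a face has at most one edge at a, the sum removes precisely the faces matching
   a elsewhere and creates none. *)
have z'E m : [set a; b] \notin m -> (z - \sum_(s | good s) fan s) m
    = z m - \sum_(s | good s) (if [set a; s] \in m then z m else 0).
  move=> abm; rewrite 2!ffunE sum_ffunE; congr (_ - _); apply: eq_bigr => s _.
  by rewrite ffunE ins_delE [X in _ + X]ffunE [X in - X]ffunE (negPf abm) oppr0 addr0.
exists (z - \sum_(s | good s) fan s); split=> //.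
- rewrite opprB addrC subrK; apply: (subspace_sum _ sQ) => // s gs.
  have := gs; rewrite /good !inE negb_or -andbA => /and3P[nsa nsb sS].
  by apply: Q_fan kE aS bS sS nab _ _ (delZ s gs); rewrite eq_sym.
- move=> m s zm asm; apply/eqP; apply: contraNT zm => nsb.
  have [mS|nmS] := boolP (m \in matching_complex S); last first.
    by rewrite (matching_chain_out z'Z.1 nmS).
  have [s' ss' s'S] := matching_edge mS asm (set21 a s).
  have gs : good s.
    by move: s'S; rewrite -(edgeIr ss') /good !inE negb_or nsb => /andP[-> ->].
  have abm : [set a; b] \notin m.
    apply/negP => abm; have := matching_disjoint mS asm abm (set21 a s) (set21 a b).
    by move/edgeIr/eqP; rewrite (negPf nsb).
  rewrite z'E // (bigD1 s) //= asm big1 ?addr0 ?subrr // => t /andP[gt nts].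
  case: ifP => // atm; have := matching_disjoint mS asm atm (set21 a s) (set21 a t).
  by move/edgeIr/eqP; rewrite eq_sym (negPf nts).
- move=> m zm abm; apply: contraNneq zm => zm0.
  by rewrite z'E // zm0 big1 ?subr0 // => s _; rewrite if_same.
Qed.

(** The cone ab /\ z consists of matchings: faces of z containing ab are killed, and the others
    touch neither a nor b. *)
Lemma edge_cone a b z : a \in S -> b \in S -> a != b -> cycle_in S k z ->
  (forall m s, z m != 0 -> [set a; s] \in m -> s = b) ->
  (forall m s, z m != 0 -> [set b; s] \in m -> s = a) ->
  boundary_in S k z.
Proof.
move=> aS bS nab [Cz dz] onlya onlyb.
exists (ins [set a; b] z); last by rewrite boundary_ins dz linear0 subr0.
move=> m; rewrite ffunE; case: ifP => [abm|_]; last by rewrite eqxx.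
rewrite mulf_eq0 negb_or => /andP[_ zm]; have [mS mk] := Cz _ zm.
rewrite (cardsD1 [set a; b]) abm mk; split=> //.
have sab : [set a; b] \subset S by apply/subsetP => v; rewrite !inE => /orP[]/eqP->.
suff mS' : m :\ [set a; b] \in matching_complex (S :\: [set a; b]).
  rewrite -(setD1K abm) -[S](setID _ [set a; b]) (setIidPr sab).
  apply: matchingU => //; last by apply: matching1; rewrite cards2 nab.
  by rewrite -setI_eq0 setIDA setDIl setDv set0I.
apply/matchingP; split=> [|e em]; first by have /matchingP[] := mS.
have [-> eS] := (matchingP _ _ mS).2 _ em; split=> //.
have nab' : e != [set a; b] by move: em; rewrite !inE => /andP[].
rewrite subsetD eS /= disjoint_sym disjoint_edge //; apply/negP => ve.
  have [s es _] := matching_edge mS em ve.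
  by case/eqP: nab'; rewrite es (onlya _ s zm) -?es.
have [s es _] := matching_edge mS em ve.
by case/eqP: nab'; rewrite es (onlyb _ s zm) -?es // setUC.
Qed.

(** Only the coefficients on leading faces are prescribed, those that match a and b outside {a, b};
    elsewhere y may be any completion to a cycle. *)
Hypothesis Q_lift : forall k' a b s t c, k = k'.+2 ->
  a \in S -> b \in S -> s \in S -> t \in S -> a != b -> uniq [:: a; b; s; t] ->
  cycle_in (S :\: [set a; b; s; t]) k' c ->
  exists y, [/\ cycle_in S k y, Q y
    & forall m s' t', s' \notin [set a; b] -> t' \notin [set a; b] ->
       [set a; s'] \in m -> [set b; t'] \in m ->
       y m = ins [set a; s] (ins [set b; t] c) m].

(** A leading face determines the partners s of a and t of b, so subtracting one lift for each pair
    (s, t) clears all leading faces independently. Stripping a, stripping b and a final cone do the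
    rest. *)
Lemma cycle_elimination a b z : a \in S -> b \in S -> a != b ->
  cycle_in S k z -> Q z.
Proof.
move=> aS bS nab zZ.
pose good (p : T * T) := [&& p.1 \in S, p.2 \in S & uniq [:: a; b; p.1; p.2]].
pose lifts p y := [/\ cycle_in S k y, Q y
    & forall m s' t', s' \notin [set a; b] -> t' \notin [set a; b] ->
       [set a; s'] \in m -> [set b; t'] \in m ->
       y m = if ([set a; p.1] \in m) && ([set b; p.2] \in m) then z m else 0].
have [y yP] : exists y : T * T -> chain F {set T}, forall p, good p -> lifts p (y p).
  apply: (@fin_all_exists _ _ (fun p y => good p -> lifts p y)) => -[s t].
  have [/and3P[/= sS tS u]|] := boolP (good (s, t)); last by exists 0.
  have [|[k' kE]] : (k < 2)%N \/ exists k', k = k'.+2.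
    by case: (k) => [|[|k']]; [left | left | right; exists k'].
    (* With fewer than two edges per face there are no leading faces, and 0 is a lift. *)
    move=> k2; exists 0; split.
    - by case: (cycle_in_subspace F S k).
    - by case: sQ.
    - move=> m s' t' _ _ _ _ /=; rewrite ffunE; case: ifP => // /andP[asm btm].
      apply/esym/eqP; apply: contraTT k2 => /zZ.1[_ <-].
      rewrite -leqNgt (cardsD1 [set a; s]) asm (cardsD1 [set b; t]) !inE btm andbT.
      case: eqP => //= /setP/(_ b); move: u; rewrite /= !inE !eqxx.
      by rewrite (eq_sym b a) (negPf nab) /= !negb_or => /and4P[_ /andP[/negPf->]].
  (* The coefficient of as /\ bt in z; contracting in the opposite order to the insertions avoids a
     sign. *)
  have dZ : cycle_in (S :\: [set a; b; s; t]) k' (del [set b; t] (del [set a; s] z)).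
    have -> : S :\: [set a; b; s; t] = S :\: [set a; s] :\: [set b; t].
      by apply/setP => v; rewrite !inE; do 4!case: eqP => //=.
    by apply: cycle_in_del; apply: cycle_in_del; rewrite -kE.
  have [y [yZ Qy yE]] := Q_lift kE aS bS sS tS nab u dZ.
  exists y => _; split=> // m s' t' ns' nt' asm btm; rewrite (yE _ s' t') //=.
  rewrite ffunE; case: ifP => //= asm'; rewrite ins_delE !inE.
  have -> : [set b; t] != [set a; s].
    apply/eqP => /setP/(_ b); move: u; rewrite /= !inE !eqxx.
    by rewrite (eq_sym b a) (negPf nab) /= !negb_or => /and4P[_ /andP[/negPf->]].
  case btm': ([set b; t] \in m) => /=; last by rewrite mulr0.
  by have := ins_delE [set a; s] z m; rewrite asm' ffunE asm'.
have z1Z : cycle_in S k (z - \sum_(p | good p) y p).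
  apply: (subspaceB (cycle_in_subspace _ _ _)) => //.
  by apply: (subspace_sum _ (cycle_in_subspace _ _ _)) => p gp; have [] := yP p gp.
have Qy : Q (\sum_(p | good p) y p) by apply: (subspace_sum _ sQ) => p gp;
  have [] := yP p gp.
rewrite -(subrK (\sum_(p | good p) y p) z); apply: (subspaceD sQ) => //.
move: z1Z; set z1 := z - _ => z1Z.
have nolead m s t : z1 m != 0 -> s \notin [set a; b] -> t \notin [set a; b] ->
    [set a; s] \in m -> [set b; t] \notin m.
  move=> z1m nsab ntab asm; apply: contraNN z1m => btm.
  have [mS|nmS] := boolP (m \in matching_complex S); last first.
    by rewrite (matching_chain_out z1Z.1 nmS).
  have gst : good (s, t).
    have [s' /edgeIr <- sS] := matching_edge mS asm (set21 a s).
    have [t' /edgeIr <- tS] := matching_edge mS btm (set21 b t).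
    move: sS tS nsab ntab; rewrite /good /= !inE !negb_or nab.
    move=> /andP[_ ->] /andP[_ ->] /andP[nsa nsb] /andP[nta ntb].
    rewrite !(eq_sym a) !(eq_sym b) nsa nsb nta ntb !andbT /=.
    apply/eqP => st; subst t.
    have := matching_disjoint mS asm btm (set22 a s) (set22 b s).
    move=> /setP/(_ a); rewrite !inE eqxx (negPf nab) /= eq_sym (negPf nsa).
    by [].
  rewrite /z1 !ffunE sum_ffunE (bigD1 (s, t)) //= big1 => [|[s' t'] /andP[g' neq]].
    by have [_ _ /(_ m s t nsab ntab asm btm) ->] := yP _ gst; rewrite asm btm addr0 subrr.
  have [_ _ /(_ m s t nsab ntab asm btm) ->] := yP _ g';
    case: ifP => // /andP[/= asm' btm'].
  have e1 := edgeIr (matching_disjoint mS asm asm' (set21 _ _) (set21 _ _)).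
  have e2 := edgeIr (matching_disjoint mS btm btm' (set21 _ _) (set21 _ _)).
  by move: neq; rewrite e1 e2 eqxx.
have [z2 [z2Z Qz2 z2a z2z]] := strip_vertex aS bS nab z1Z nolead.
have nolead2 m s t : z2 m != 0 -> s \notin [set b; a] -> t \notin [set b; a] ->
    [set b; s] \in m -> [set a; t] \notin m.
  move=> z2m _ ntab _; apply/negP => /(z2a _ _ z2m) tb.
  by move: ntab; rewrite tb !inE eqxx.
have nba : b != a by rewrite eq_sym.
have [z3 [z3Z Qz3 z3b z3z]] := strip_vertex bS aS nba z2Z nolead2.
rewrite -(subrK z2 z1); apply: (subspaceD sQ) => //.
rewrite -(subrK z3 z2); apply: (subspaceD sQ) => //.
apply: Q_boundary; apply: (edge_cone aS bS nab z3Z) => [m s z3m asm|]; last exact: z3b.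
(* Stripping b can create only faces containing ab, and there a is already matched to b; so what was
   achieved at a persists. *)
have [bam|bam] := boolP ([set b; a] \in m); last exact: (z2a m s (z3z _ z3m bam) asm).
have := matching_disjoint (z3Z.1 _ z3m).1 asm bam (set21 _ _) (set22 _ _).
by rewrite (setUC [set b]) => /edgeIr.
Qed.

End Step.

End Elimination.

(** * Types and pentagons *)

Section Types.

Variables (F : fieldType) (T : finType).
Implicit Types (a b s t u : T) (S : {set T}) (m : {set {set T}}).
Implicit Types (c x y z : chain F {set T}) (k : nat) (ty : seq (nat * nat)).

(** Blocks are peeled off a shrinking vertex set, which builds in disjointness and covering. The
    second entry of a block [n, d] is its number of edges per face, so no dimension shift occurs. *)
Fixpoint typed S ty c : Prop :=
  if ty is (n, k) :: ty' then
    exists S1 x y, [/\ S1 \subset S, #|S1| = n, cycle_in S1 k x,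
                       typed (S :\: S1) ty' y & c = wedge x y]
  else S = set0 /\ c = vac F _.

Definition type_dim ty := sumn (map snd ty).

Lemma disjointsD S S1 : [disjoint S1 & S :\: S1].
Proof. by rewrite -setI_eq0 setIDA setDIl setDv set0I. Qed.

Lemma disjointsU S1 S2 S : [disjoint S1 & S] -> [disjoint S2 & S] ->
  [disjoint S1 :|: S2 & S].
Proof. by rewrite -!setI_eq0 setIUl => /eqP-> /eqP->; rewrite setU0. Qed.

Lemma setUDS S S1 : S1 \subset S -> S1 :|: (S :\: S1) = S.
Proof. by move=> sS; rewrite -{1}(setIidPr sS) setID. Qed.

Lemma setUDl S1 S2 : [disjoint S1 & S2] -> (S1 :|: S2) :\: S1 = S2.
Proof.
by move=> dS; rewrite setDUl setDv set0U; apply/setDidPl; rewrite disjoint_sym.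
Qed.

Lemma typed_cycle S ty c : typed S ty c -> cycle_in S (type_dim ty) c.
Proof.
elim: ty S c => [|[n k] ty IH] S c /=; first by move=> [_ ->]; exact: cycle_in_vac.
move=> [S1 [x [y [sS _ Zx /IH Zy ->]]]]; rewrite -(setUDS sS).
exact: cycle_in_wedge (disjointsD _ _) Zx Zy.
Qed.

Lemma typed_cons S1 S2 n k ty x y : [disjoint S1 & S2] -> #|S1| = n ->
  cycle_in S1 k x -> typed S2 ty y -> typed (S1 :|: S2) ((n, k) :: ty) (wedge x y).
Proof.
by move=> dS cS Zx ty_y; exists S1, x, y; rewrite subsetUl setUDl.
Qed.

Lemma typed_cat S1 S2 ty1 ty2 x y : [disjoint S1 & S2] ->
  typed S1 ty1 x -> typed S2 ty2 y -> typed (S1 :|: S2) (ty1 ++ ty2) (wedge x y).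
Proof.
elim: ty1 S1 x => [|[n k] ty1 IH] S1 x dS.
  by move=> [-> ->]; rewrite set0U wedge_vac.
move=> [S' [x' [y' [sS' cS' Zx' ty1_y' ->]]]] ty2_y; rewrite -wedgeA.
rewrite -{1}(setUDS sS') -setUA; apply: typed_cons => //.
  rewrite disjoint_sym disjointsU // disjoint_sym ?disjointsD //.
  exact: disjointWl sS' dS.
by apply: IH => //; exact: disjointWl (subsetDl _ _) dS.
Qed.

Lemma typed_catP S ty1 ty2 c : typed S (ty1 ++ ty2) c ->
  exists S1 x y, [/\ S1 \subset S, typed S1 ty1 x, typed (S :\: S1) ty2 y & c = wedge x y].
Proof.
elim: ty1 S c => [|[n k] ty1 IH] S c /=.
  by move=> ty2c; exists set0, (vac F _), c; rewrite sub0set setD0 wedge_vac.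
move=> [S' [x' [y' [sS' cS' Zx' /IH[S1 [x [y [sS1 ty_x ty_y ->]]]] ->]]]].
have dS : [disjoint S' & S1].
  by rewrite disjoint_sym; move: sS1; rewrite subsetD => /andP[].
exists (S' :|: S1), (wedge x' x), y; split.
- by rewrite subUset sS'; exact: subset_trans sS1 (subsetDl _ _).
- exact: typed_cons.
- by rewrite -setDDl.
- by rewrite wedgeA.
Qed.

(** The sign of graded commutativity is absorbed into one of the cycles. *)
Lemma typed_swap S p1 p2 ty c : typed S (p1 :: p2 :: ty) c -> typed S (p2 :: p1 :: ty) c.
Proof.
case: p1 p2 => [n1 k1] [n2 k2].
move=> [S1 [x [y [sS1 cS1 Zx [S2 [x' [y' [sS2 cS2 Zx' ty_y' ->]]]] ->]]]].
move: sS2; rewrite subsetD => /andP[sS2 dS].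
exists S2, x', ((-1) ^+ (k1 * k2) *: wedge x y'); split=> //.
  exists S1, ((-1) ^+ (k1 * k2) *: x), y'; split=> //.
  - by rewrite subsetD sS1 disjoint_sym.
  - exact: (subspaceZ _ (cycle_in_subspace _ _ _)).
  - by rewrite setDDl setUC -setDDl.
  - by rewrite wedgeZl.
rewrite linearZ /= !wedgeA.
rewrite (wedgeC (matching_chain_homogeneous Zx.1) (matching_chain_homogeneous Zx'.1)).
by rewrite wedgeZl.
Qed.

(** Generation modulo boundaries at the level of chains; quotients enter only at the end. *)
Definition generated S k (P : chain F {set T} -> Prop) c :=
  lspan (fun x => boundary_in S k x \/ cycle_in S k x /\ P x) c.

Lemma generated_subspace S k P : subspace (generated S k P).
Proof. exact: lspan_subspace. Qed.

Lemma generated_boundary S k P c : boundary_in S k c -> generated S k P c.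
Proof. by move=> Bc; apply: mem_lspan; left. Qed.

Lemma generated_mem S k (P : chain F {set T} -> Prop) c :
  cycle_in S k c -> P c -> generated S k P c.
Proof. by move=> Zc Pc; apply: mem_lspan; right. Qed.

Lemma generated_typed S k ty c : k = type_dim ty -> typed S ty c ->
  generated S k (typed S ty) c.
Proof. by move=> -> ty_c; apply: generated_mem => //; exact: typed_cycle. Qed.

Lemma generated_ind S k P c (Q : chain F {set T} -> Prop) : subspace Q ->
  (forall x, boundary_in S k x -> Q x) ->
  (forall x, cycle_in S k x -> P x -> Q x) -> generated S k P c -> Q c.
Proof. by move=> sQ QB QP; apply=> // x [/QB|[Zx /(QP _ Zx)]]. Qed.

Lemma generated_sub S k P P' c : generated S k P c ->
  (forall x, cycle_in S k x -> P x -> generated S k P' x) -> generated S k P' c.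
Proof.
move=> Pc PP'; apply: (generated_ind (generated_subspace S k P') _ _ Pc) => //.
by move=> x; exact: generated_boundary.
Qed.

Lemma wedge_subspacer x Q : subspace Q -> subspace (fun y => Q (wedge x y)).
Proof.
by move=> sQ; split=> [|a y y' Qy Qy']; [rewrite linear0; case: sQ | rewrite linearP;
  exact: sQ.2].
Qed.

Lemma wedge_subspacel y Q : subspace Q -> subspace (fun x => Q (wedge x y)).
Proof.
move=> sQ; split=> [|a x x' Qx Qx']; first by rewrite wedge0l; case: sQ.
by rewrite wedgeDl wedgeZl; exact: sQ.2.
Qed.

(** Multiplication by a fixed cycle is linear and preserves boundaries, so it suffices to treat
    products with generators. *)
Lemma generated_wedger S1 S2 S k1 k2 k P P' x y : S = S1 :|: S2 -> k = (k1 + k2)%N ->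
  [disjoint S1 & S2] -> cycle_in S1 k1 x -> generated S2 k2 P y ->
  (forall y, cycle_in S2 k2 y -> P y -> generated S k P' (wedge x y)) ->
  generated S k P' (wedge x y).
Proof.
move=> -> -> dS Zx Py PP'; apply: (generated_ind (wedge_subspacer _ (generated_subspace _ _ _)) _ _ Py) => //.
by move=> c Bc; apply: generated_boundary; exact: boundary_in_wedger.
Qed.

Lemma generated_wedgel S1 S2 S k1 k2 k P P' x y : S = S1 :|: S2 -> k = (k1 + k2)%N ->
  [disjoint S1 & S2] -> cycle_in S2 k2 y -> generated S1 k1 P x ->
  (forall x, cycle_in S1 k1 x -> P x -> generated S k P' (wedge x y)) ->
  generated S k P' (wedge x y).
Proof.
move=> -> -> dS Zy Px PP'; apply: (generated_ind (wedge_subspacel _ (generated_subspace _ _ _)) _ _ Px) => //.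
by move=> c Bc; apply: generated_boundary; exact: boundary_in_wedgel.
Qed.

(** Lets a relation between types be applied to the first blocks of a longer type. It is assumed on
    every subset, because the vertices covered by these blocks vary with the cycle. *)
Lemma generated_typed_head S k ty1 ty1' ty2 c : k = (type_dim ty1 + type_dim ty2)%N ->
  type_dim ty1 = type_dim ty1' ->
  (forall S' x, S' \subset S -> typed S' ty1 x ->
     generated S' (type_dim ty1) (typed S' ty1') x) ->
  typed S (ty1 ++ ty2) c -> generated S k (typed S (ty1' ++ ty2)) c.
Proof.
move=> kE dE head /typed_catP[S1 [x [y [sS1 ty_x ty_y ->]]]].
apply: (generated_wedgel (esym (setUDS sS1)) kE (disjointsD _ _) (typed_cycle ty_y)
  (head _ _ sS1 ty_x)) => x' Zx' ty_x'.
rewrite -{2}(setUDS sS1) kE; apply: generated_mem.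
  by rewrite -{1}(setUDS sS1); exact: cycle_in_wedge (disjointsD _ _) Zx'
    (typed_cycle ty_y).
exact: typed_cat (disjointsD _ _) ty_x' ty_y.
Qed.

End Types.

(** * Pentagon cycles, the cycles of type [5,2] used for lifting *)

Section Pentagons.

Variables (F : fieldType) (T : finType).
Implicit Types (a b s t u : T) (e f : {set T}) (S : {set T}) (m : {set {set T}}).
Implicit Types (c x y z : chain F {set T}) (k : nat) (ty : seq (nat * nat)).

Definition edge2 e f : chain F {set T} := ins e (ins f (vac F _)).

Lemma edge2C e f : edge2 e f = - edge2 f e.
Proof. exact: ins_ins. Qed.

Lemma boundary_edge2 e f : boundary (edge2 e f) = ins f (vac F _) - ins e (vac F _).
Proof. by rewrite !boundary_ins boundary_vac linear0 subr0. Qed.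

Lemma wedge_edge2 e f x : wedge (edge2 e f) x = ins e (ins f x).
Proof. by rewrite !wedge_ins wedge_vac. Qed.

Lemma matching_chain_edge S a b : a != b -> [set a; b] \subset S ->
  matching_chain S 1 (ins [set a; b] (vac F _)).
Proof.
move=> nab sub; rewrite subUset !sub1set in sub; case/andP: sub => aS bS.
apply: matching_chain_ins_edge nab aS bS (subxx _) _.
exact: matching_chain_vac.
Qed.

Lemma matching_chain_edge2 S a b s t : uniq [:: a; b; s; t] ->
  [set a; b; s; t] \subset S -> matching_chain S 2 (edge2 [set a; b] [set s; t]).
Proof.
rewrite /= !inE !negb_or andbT => /and3P[/and3P[nab nas nat] /andP[nbs nbt] nst].
rewrite !subUset !sub1set -!andbA => /and4P[aS bS sS tS].
apply: matching_chain_ins_edge nab aS bS (subxx _) _.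
apply: matching_chain_edge nst _; apply/subsetP => v.
rewrite !inE => /orP[]/eqP->; rewrite ?sS ?tS andbT negb_or.
  by rewrite !(eq_sym s) nas nbs.
by rewrite !(eq_sym t) nat nbt.
Qed.

(* The 5-cycle as, bt, su, ab, tu of the Petersen graph M_5. *)
Definition pentagon a b s t u : chain F {set T} :=
  edge2 [set a; s] [set b; t] + edge2 [set b; t] [set s; u] +
  edge2 [set s; u] [set a; b] + edge2 [set a; b] [set t; u] +
  edge2 [set t; u] [set a; s].

Lemma pentagon_cycle S a b s t u : uniq [:: a; b; s; t; u] ->
  [set a; b; s; t; u] \subset S -> cycle_in S 2 (pentagon a b s t u).
Proof.
move=> uq sub; split; last first.
  rewrite /pentagon !linearD /= !boundary_edge2.
  (* Each pair of consecutive disjoint edges contributes the difference of its ends along a closed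
     walk. *)
  have telescope x y z : (y - x) + (z - y) = z - x by rewrite addrC subrKA.
  by rewrite !telescope subrr.
have E p q r v : uniq [:: p; q; r; v] -> [set p; q; r; v] \subset [set a; b; s; t; u] ->
    matching_chain S 2 (edge2 [set p; q] [set r; v]).
  by move=> ? sub'; apply: matching_chain_edge2 => //; exact: subset_trans sub' sub.
have sQ := matching_chain_subspace F S 2.
move: uq; rewrite /= !inE !negb_or andbT.
case/and4P=> /and4P[ab as_ at_ au] /and3P[bs bt bu] /andP[st su] tu.
rewrite /pentagon; do 4?[apply: (subspaceD sQ)]; apply: E.
all: try by apply/subsetP => v; rewrite !inE -!orbA => /or4P[]->; rewrite ?orbT.
all: rewrite /= !inE !negb_or.
all: rewrite ?(eq_sym _ a) ?(eq_sym s b) ?(eq_sym t b) ?(eq_sym u b) ?(eq_sym t s)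
  ?(eq_sym u s) ?(eq_sym u t).
all: by rewrite ?ab ?as_ ?at_ ?au ?bs ?bt ?bu ?st ?su ?tu.
Qed.

End Pentagons.

(** * Lifting leading terms *)

Section Lifting.

Variables (F : fieldType) (T : finType).
Implicit Types (a b s t u : T) (e f g : {set T}) (S : {set T}) (m : {set {set T}}).
Implicit Types (c x y z : chain F {set T}) (k : nat) (ty : seq (nat * nat)).
Implicit Types (Q : chain F {set T} -> Prop).

(** If m covers v by an edge other than e, removing e leaves v covered, which no face of c does.
    With v = a or v = b this discards the terms that are invisible on leading faces. *)
Lemma ins_face e c m S k g v : matching_chain S k c -> v \notin S -> v \in g ->
  g \in m -> g != e -> ins e c m = 0.
Proof.
move=> Cc vS vg gm neq; rewrite ffunE; case: ifP => // em.
apply/eqP; rewrite mulf_eq0; apply/orP; right; apply: contraNT vS => /Cc[mS _].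
have [_ /(_ g)] := matchingP _ _ mS; rewrite !inE neq gm => /(_ isT)[_ /subsetP].
exact.
Qed.

Lemma ins2_face e f c m S k g v : matching_chain S k c -> v \notin S -> v \in g ->
  g \in m -> g != e -> g != f -> ins e (ins f c) m = 0.
Proof.
move=> Cc vS vg gm ge gf; rewrite ffunE; case: ifP => // em.
by rewrite (ins_face Cc vS vg) ?mulr0 // !inE ge.
Qed.

Lemma neq_edge a b s g : a \in g -> a != b -> a != s -> g != [set b; s].
Proof.
by move=> ag ab as_; apply: contraTneq ag => ->; rewrite !inE negb_or ab.
Qed.

(** The conclusion demanded of a leading term by the elimination. It is closed under linear
    combinations of c, so lifts need only be built for generators. *)
Definition liftable S k Q a b s t c :=
  exists y, [/\ cycle_in S k y, Q y
    & forall m s' t', s' \notin [set a; b] -> t' \notin [set a; b] ->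
       [set a; s'] \in m -> [set b; t'] \in m ->
       y m = ins [set a; s] (ins [set b; t] c) m].

Lemma liftable_subspace S k Q a b s t : subspace Q -> subspace (liftable S k Q a b s t).
Proof.
move=> sQ; split.
  exists 0; split; [by case: (cycle_in_subspace F S k) | by case: sQ |].
  by move=> *; rewrite !linear0.
move=> r x x' [y [Zy Qy yE]] [y' [Zy' Qy' yE']]; exists (r *: y + y'); split.
- exact: (cycle_in_subspace F S k).2.
- exact: sQ.2.
- move=> m s' t' ns nt asm btm; rewrite !linearP /= 2![in LHS]ffunE 2![in RHS]ffunE.
  by rewrite (yE m s' t') // (yE' m s' t').
Qed.

Section Fixed.

Variables (S : {set T}) (k : nat) (Q : chain F {set T} -> Prop) (a b s t : T).
Hypothesis Q_boundary : forall c, boundary_in S k.+2 c -> Q c.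
Hypothesis abstS : [set a; b; s; t] \subset S.
Hypothesis uq : uniq [:: a; b; s; t].

Let S' := S :\: [set a; b; s; t].

Let matching_chain_ins2 k' c : matching_chain S' k' c ->
  matching_chain S k'.+2 (ins [set a; s] (ins [set b; t] c)).
Proof.
move: uq abstS; rewrite /= !inE !negb_or andbT => /and3P[/and3P[ab as_ at_] /andP[bs bt] st].
rewrite !subUset !sub1set -!andbA => /and4P[aS bS sS tS] Cc.
apply: matching_chain_ins_edge as_ aS sS (subxx _) _.
apply: matching_chain_ins_edge bt _ _ _ Cc; rewrite ?inE ?bS ?tS ?negb_or ?andbT.
- by rewrite eq_sym ab.
- by rewrite !(eq_sym t) at_ st.
- by apply/subsetP => v; rewrite !inE; do ?case: eqP => //=.
Qed.

(** The lift of as /\ bt /\ ∂d is ∂(as /\ bt /\ d): its two extra terms bt /\ d and as /\ d leave a,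
    respectively b, unmatched. *)
Lemma liftable_boundary c : boundary_in S' k c -> liftable S k.+2 Q a b s t c.
Proof.
move=> [d Cd ->]; exists (boundary (ins [set a; s] (ins [set b; t] d))).
have Bd : boundary_in S k.+2 (boundary (ins [set a; s] (ins [set b; t] d))).
  by exists (ins [set a; s] (ins [set b; t] d)) => //; exact: matching_chain_ins2.
split; [exact: boundary_in_cycle | exact: Q_boundary | move=> m s' t' ns' nt' asm btm].
have aS' : a \notin S' by rewrite !inE eqxx.
have bS' : b \notin S' by rewrite !inE eqxx !orbT.
move: uq; rewrite /= !inE !negb_or andbT => /and3P[/and3P[ab as_ at_] /andP[bs bt] st].
rewrite !boundary_ins linearB /= opprB addrA 2!ffunE [X in _ + X]ffunE.
rewrite (ins_face Cd aS' (set21 a s') asm) ?(ins_face Cd bS' (set21 b t') btm) ?oppr0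
  ?add0r ?addr0 //.
  by apply: (neq_edge (set21 b t')) => //; rewrite eq_sym.
exact: (neq_edge (set21 a s')).
Qed.

(** Of the five terms of the pentagon only as /\ bt matches both a and b outside {a, b}; c touches
    neither, so the product has the prescribed leading faces. *)
Lemma liftable_pentagon u c : u \in S' -> cycle_in (S' :\ u) k c ->
  Q (wedge (pentagon F a b s t u) c) -> liftable S k.+2 Q a b s t c.
Proof.
move=> uS' Zc Qc; exists (wedge (pentagon F a b s t u) c).
have aS' : a \notin S' :\ u by rewrite !inE eqxx !andbF.
have bS' : b \notin S' :\ u by rewrite !inE eqxx !orbT !andbF.
move: uS'; rewrite !inE !negb_or -!andbA => /and5P[ua ub us ut uS].
have uq5 : uniq [:: a; b; s; t; u].
  move: uq; rewrite /= !inE !negb_or !andbT => /and3P[/and3P[-> -> ->] /andP[-> ->] ->].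
  by rewrite !(eq_sym _ u) ua ub us ut.
have sub5 : [set a; b; s; t; u] \subset S by rewrite subUset abstS sub1set.
split=> //.
  have -> : S = [set a; b; s; t; u] :|: (S' :\ u).
    apply/setP => v; have := subsetP sub5 v; rewrite !inE => sub.
    by case vS: (v \in S) sub; do ?case: eqP => //= _; move=> // /(_ isT).
  apply: (cycle_in_wedge _ (pentagon_cycle _ uq5 (subxx _)) Zc).
  rewrite -setI_eq0; apply/eqP/setP => v; rewrite !inE.
  by do ?case: eqP => //=.
move=> m s' t' ns' nt' asm btm.
move: uq; rewrite /= !inE !negb_or andbT => /and3P[/and3P[ab as_ at_] /andP[bs bt] st].
have [ba au bu] : [/\ b != a, a != u & b != u] by rewrite !(eq_sym _ u) eq_sym.
have nab : [set a; s'] != [set a; b].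
  by apply: contraNneq ns' => /edgeIr->; rewrite !inE eqxx orbT.
rewrite /pentagon !wedgeDl !wedge_edge2 4!ffunE.
rewrite (ins2_face (e := [set b; t]) (f := [set s; u]) Zc.1 aS' (set21 a s') asm);
  last 2 first.
- exact: (neq_edge (set21 a s')).
- exact: (neq_edge (set21 a s')).
rewrite (ins2_face (e := [set s; u]) (f := [set a; b]) Zc.1 aS' (set21 a s') asm);
  last 2 first.
- exact: (neq_edge (set21 a s')).
- exact: nab.
rewrite (ins2_face (e := [set a; b]) (f := [set t; u]) Zc.1 aS' (set21 a s') asm);
  last 2 first.
- exact: nab.
- exact: (neq_edge (set21 a s')).
rewrite (ins2_face (e := [set t; u]) (f := [set a; s]) Zc.1 bS' (set21 b t') btm) ?addr0 //.
- exact: (neq_edge (set21 b t')).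
- exact: (neq_edge (set21 b t')).
Qed.

End Fixed.

(** The block [1,0] supplies the free vertex u: it joins a, b, s, t in a pentagon, which turns [1,0]
    /\ ty into [5,2] /\ ty. *)
Lemma liftable_generated S k Q a b s t ty c : subspace Q ->
  (forall x, boundary_in S k.+2 x -> Q x) ->
  (forall x, typed S ((5, 2)%N :: ty) x -> Q x) ->
  [set a; b; s; t] \subset S -> uniq [:: a; b; s; t] -> k = type_dim ty ->
  generated (S :\: [set a; b; s; t]) k
    (typed (S :\: [set a; b; s; t]) ((1, 0)%N :: ty)) c ->
  liftable S k.+2 Q a b s t c.
Proof.
move=> sQ QB Qty sub uq kE; set S' := S :\: _.
apply: (generated_ind (liftable_subspace _ _ _ _ _ _ sQ)) => x.
  exact: liftable_boundary.
move=> _ [S1 [x0 [y [sS1 /eqP/cards1P[u S1E] Zx0 ty_y ->]]]]; subst S1.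
have uS' : u \in S' by rewrite sub1set in sS1.
rewrite (matching_chain0E Zx0.1) wedgeZl wedge_vac.
apply: (subspaceZ _ (liftable_subspace _ _ _ _ _ _ sQ)).
apply: (liftable_pentagon sub uq uS'); first by rewrite kE; exact: typed_cycle.
apply: Qty; exists [set a; b; s; t; u], (pentagon F a b s t u), y.
move: uS'; rewrite !inE !negb_or -!andbA => /and5P[ua ub us ut uS].
have uq5 : uniq [:: a; b; s; t; u].
  move: uq; rewrite /= !inE !negb_or !andbT => /and3P[/and3P[-> -> ->] /andP[-> ->] ->].
  by rewrite !(eq_sym _ u) ua ub us ut.
split=> //; first by rewrite subUset sub sub1set.
- have -> : [set a; b; s; t; u] = [set x in [:: a; b; s; t; u]].
    by apply/setP => v; rewrite !inE -!orbA.
  by rewrite cardsE (card_uniqP uq5).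
- exact: pentagon_cycle.
- by rewrite -setDDl.
Qed.

End Lifting.

(** * The two relations away from 3 *)

Section Certificates.

Variables (F : fieldType) (T : finType).
Implicit Types (a b s t u : T) (S : {set T}) (c x y z : chain F {set T}).

(* The lists below were found by integer linear programming.  The entry
   (i, j, k, l, p, q) stands for the triangle ij, kl, pq, and (a, b, s, t, u, r)
   for the pentagon on a, b, s, t, u, which avoids the vertex r. *)
Definition triangle_boundary (w : nat -> nat -> nat -> nat -> chain F {set T})
    (r : nat * nat * nat * nat * nat * nat) :=
  let: (i, j, k, l, p, q) := r in w k l p q - w i j p q + w i j k l.

Definition pentagon_sum (w : nat -> nat -> nat -> nat -> chain F {set T})
    (r : nat * nat * nat * nat * nat * nat) :=
  let: (a, b, s, t, u, _) := r in
  w a s b t + w b t s u + w s u a b + w a b t u + w t u a s.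

Definition triangles7_pos : seq (nat * nat * nat * nat * nat * nat) :=
  ([:: (0, 3, 1, 6, 2, 4); (0, 1, 2, 4, 3, 5); (0, 3, 2, 4, 5, 6);
     (0, 1, 2, 6, 3, 5); (0, 1, 2, 5, 4, 6); (0, 2, 1, 5, 3, 4);
     (0, 2, 1, 6, 3, 4); (1, 5, 2, 6, 3, 4); (0, 3, 1, 5, 4, 6);
     (1, 6, 2, 5, 3, 4); (0, 2, 3, 5, 4, 6); (0, 3, 1, 4, 2, 6);
     (0, 2, 1, 4, 5, 6); (0, 1, 3, 4, 5, 6)])%N.

Definition triangles7_neg : seq (nat * nat * nat * nat * nat * nat) :=
  ([:: (1, 6, 2, 4, 3, 5); (0, 3, 1, 6, 2, 5); (0, 2, 1, 6, 3, 5);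
     (0, 1, 2, 4, 5, 6); (0, 2, 1, 5, 4, 6); (0, 2, 3, 4, 5, 6);
     (0, 1, 2, 5, 3, 4); (0, 3, 1, 5, 2, 6); (0, 2, 1, 4, 3, 5);
     (0, 3, 1, 4, 5, 6); (0, 1, 3, 5, 4, 6); (0, 3, 2, 5, 4, 6);
     (1, 4, 2, 6, 3, 5); (0, 1, 2, 6, 3, 4)])%N.

Definition pentagons6_pos : seq (nat * nat * nat * nat * nat * nat) :=
  ([:: (0, 1, 2, 4, 3, 5); (0, 2, 4, 3, 5, 1); (0, 1, 5, 4, 3, 2)])%N.

Definition pentagons6_neg : seq (nat * nat * nat * nat * nat * nat) :=
  ([:: (0, 1, 2, 5, 3, 4); (0, 2, 5, 3, 4, 1); (0, 1, 4, 5, 3, 2)])%N.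

Definition triangles6_pos : seq (nat * nat * nat * nat * nat * nat) :=
  ([:: (0, 4, 1, 5, 2, 3); (0, 2, 1, 5, 3, 4)])%N.

Definition triangles6_neg : seq (nat * nat * nat * nat * nat * nat) :=
  ([:: (0, 2, 1, 4, 3, 5); (0, 5, 1, 4, 2, 3)])%N.

(** Formal in w: all edges and pairs of edges are listed in increasing order, so equal products are
    already the same term, and coefficients are compared. *)
Lemma triangles7_certificate (w : nat -> nat -> nat -> nat -> chain F {set T}) :
  (w 0 1 3 4 - w 0 1 3 5 - (w 0 2 3 4 - w 0 2 3 5)) *+ 3 =
  \sum_(r <- triangles7_pos) triangle_boundary w r
  - \sum_(r <- triangles7_neg) triangle_boundary w r.
Proof.
rewrite /triangles7_pos /triangles7_neg !big_cons !big_nil /triangle_boundary.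
apply/ffunP => m; rewrite !ffunE.
by ring.
Qed.

Lemma pentagons6_certificate (w : nat -> nat -> nat -> nat -> chain F {set T}) :
  (forall i j k l, w i j k l = w j i k l) ->
  (forall i j k l, w i j k l = w i j l k) ->
  (forall i j k l, w i j k l = - w k l i j) ->
  (w 0 1 3 4 - w 0 1 3 5 - (w 0 2 3 4 - w 0 2 3 5)) *+ 3 =
  \sum_(r <- pentagons6_pos) pentagon_sum w r
  - \sum_(r <- pentagons6_neg) pentagon_sum w r
  + (\sum_(r <- triangles6_pos) triangle_boundary w r
     - \sum_(r <- triangles6_neg) triangle_boundary w r).
Proof.
(* [wr] takes the second edge first, so that each rule can be instantiated at a pair in the wrong
   order; pentagons, unlike the triangles, list edges unsorted. *)
move=> wl wr0 wC; have wr k l i j := wr0 i j k l.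
rewrite /pentagons6_pos /pentagons6_neg /triangles6_pos /triangles6_neg.
rewrite !big_cons !big_nil /triangle_boundary /pentagon_sum.
rewrite ?(wl 4 3) ?(wl 5 3) ?(wl 5 4) ?(wr 4 3) ?(wr 5 3) ?(wr 5 4).
rewrite ?(wC 2 3 0 1) ?(wC 3 4 0 1) ?(wC 3 4 0 2) ?(wC 3 4 0 5) ?(wC 3 5 0 1)
  ?(wC 3 5 0 2) ?(wC 3 5 0 4) ?(wC 4 5 0 2).
apply/ffunP => m; rewrite !ffunE.
by ring.
Qed.

Lemma matching_chain_edge3 S a b s t p q : uniq [:: a; b; s; t; p; q] ->
  {subset [:: a; b; s; t; p; q] <= S} ->
  matching_chain S 3 (ins [set a; b] (edge2 F [set s; t] [set p; q])).
Proof.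
move=> uq sub.
have aS : a \in S by apply: sub; rewrite !inE eqxx.
have bS : b \in S by apply: sub; rewrite !inE eqxx ?orbT.
have uq4 : uniq [:: s; t; p; q] by move: uq => /= /and3P[].
have nab : a != b by move: uq; rewrite /= !inE !negb_or -!andbA => /andP[].
apply: matching_chain_ins_edge nab aS bS (subxx _) _.
apply: matching_chain_edge2 uq4 _; apply/subsetP => v vE.
have vl : v \in [:: s; t; p; q] by move: vE; rewrite !inE -!orbA.
rewrite inE sub ?andbT; last by rewrite inE [v \in _ :: _]inE vl !orbT.
move: uq => /= /and3P[au bu _]; rewrite !inE negb_or.
apply/andP; split; first by apply: contraNneq au => <-; rewrite inE vl orbT.
by apply: contraNneq bu => <-.
Qed.

Section Numbering.

Variables (S : {set T}) (l : seq T) (v0 : T).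
Hypothesis uniq_l : uniq l.
Hypothesis sub_l : {subset l <= S}.

Let e i j := [set nth v0 l i; nth v0 l j].

Let w i j p q := edge2 F (e i j) (e p q).

Let nth_sub r : all (fun i => i < size l)%N r -> {subset map (nth v0 l) r <= S}.
Proof. by move=> /allP lt_r v /mapP[i /lt_r lt_i ->]; apply: sub_l; exact: mem_nth. Qed.

Let nth_uniqs r : all (fun i => i < size l)%N r -> uniq r -> uniq (map (nth v0 l) r).
Proof.
move=> /allP lt_r uq; rewrite map_inj_in_uniq // => i j /lt_r lt_i /lt_r lt_j /eqP.
by rewrite nth_uniq // => /eqP.
Qed.

(** Boolean, so that the explicit lists are validated by evaluation. The sixth index of a pentagon
    is the omitted vertex, which becomes the block [1,0]. *)
Definition proper_index (r : nat * nat * nat * nat * nat * nat) :=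
  let: (i, j, p, q, x, y) := r in
  all (fun i => i < size l)%N [:: i; j; p; q; x; y] && uniq [:: i; j; p; q; x; y].

Lemma triangles_boundary_in tr : all proper_index tr ->
  boundary_in S 2 (\sum_(r <- tr) triangle_boundary w r).
Proof.
move=> /allP proper_tr; rewrite big_seq_cond.
apply: (subspace_sum _ (boundary_in_subspace F S 2)) => r /andP[/proper_tr].
case: r => [[[[[i j] p] q] x] y] /andP[lt_r uq_r] _.
exists (ins (e i j) (w p q x y)).
  exact: (matching_chain_edge3 (nth_uniqs lt_r uq_r) (nth_sub lt_r)).
rewrite boundary_ins boundary_edge2 linearB /= opprB addrA addrAC.
by rewrite /triangle_boundary.
Qed.

Lemma pentagons_sum_in Q tr : subspace Q ->
  (forall a b s t u r, uniq [:: a; b; s; t; u; r] -> {subset [:: a; b; s; t; u; r] <= S} ->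
     Q (pentagon F a b s t u)) ->
  all proper_index tr -> Q (\sum_(r <- tr) pentagon_sum w r).
Proof.
move=> sQ Qp /allP proper_tr; rewrite big_seq_cond.
apply: (subspace_sum _ sQ) => r /andP[/proper_tr].
case: r => [[[[[a b] s] t] u] r] /andP[lt_r uq_r] _.
exact: (Qp _ _ _ _ _ _ (nth_uniqs lt_r uq_r) (nth_sub lt_r)).
Qed.

End Numbering.

Definition fan a b s : chain F {set T} := ins [set a; s] (vac F _) - ins [set a;
  b] (vac F _).

(** Both factors are negated to match the left side of the certificates, with a, b, s, a', b', s'
    numbered 0 to 5. *)
Lemma wedge_fan a b s a' b' s' : wedge (fan a b s) (fan a' b' s') =
  edge2 F [set a; b] [set a'; b'] - edge2 F [set a; b] [set a'; s']
  - (edge2 F [set a; s] [set a'; b'] - edge2 F [set a; s] [set a'; s']).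
Proof.
rewrite /fan wedgeBl !wedge_ins !wedge_vac !(linearB (ins _)) /= -!/(edge2 F _ _).
by rewrite !opprB addrC.
Qed.

Hypothesis three_unit : 3%:R != 0 :> F.

(** The certificates yield three times the wanted chain; this is where characteristic 3 is
    excluded. *)
Lemma subspace_div3 Q x : subspace Q -> Q (x *+ 3) -> Q x.
Proof.
move=> sQ Q3; have -> : x = (3%:R)^-1 *: (x *+ 3).
  by rewrite -[x *+ 3]scaler_nat scalerA mulVf // scale1r.
exact: subspaceZ.
Qed.

Lemma fan_fan_boundary S a b s a' b' s' u :
  uniq [:: a; b; s; a'; b'; s'; u] -> {subset [:: a; b; s; a'; b'; s'; u] <= S} ->
  boundary_in S 2 (wedge (fan a b s) (fan a' b' s')).
Proof.
move=> uq sub; have sB := boundary_in_subspace F S 2.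
apply: (subspace_div3 sB); rewrite wedge_fan.
pose e i j := [set nth a [:: a; b; s; a'; b'; s'; u] i; nth a [:: a; b; s; a'; b'; s';
  u] j].
have := triangles7_certificate (fun i j p q => edge2 F (e i j) (e p q)).
rewrite /= => ->.
by apply: (subspaceB sB); exact: triangles_boundary_in.
Qed.

Lemma fan_fan_pentagons S Q a b s a' b' s' : subspace Q ->
  (forall x, boundary_in S 2 x -> Q x) ->
  (forall a b s t u r, uniq [:: a; b; s; t; u; r] -> {subset [:: a; b; s; t; u; r] <= S} ->
     Q (pentagon F a b s t u)) ->
  uniq [:: a; b; s; a'; b'; s'] -> {subset [:: a; b; s; a'; b'; s'] <= S} ->
  Q (wedge (fan a b s) (fan a' b' s')).
Proof.
move=> sQ QB Qp uq sub; apply: (subspace_div3 sQ); rewrite wedge_fan.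
pose e i j := [set nth a [:: a; b; s; a'; b'; s'] i; nth a [:: a; b; s; a'; b'; s'] j].
have eC i j : e i j = e j i by rewrite /e setUC.
have /= -> := @pentagons6_certificate (fun i j p q => edge2 F (e i j) (e p q)).
- apply: (subspaceD sQ).
    by apply: (subspaceB sQ); exact: (pentagons_sum_in a uq sub sQ Qp).
  by apply: QB; apply: (subspaceB (boundary_in_subspace F S 2));
    exact: triangles_boundary_in.
- by move=> i j p q; rewrite (eC i j).
- by move=> i j p q; rewrite (eC p q).
- by move=> i j p q; exact: edge2C.
Qed.

End Certificates.

(** * The induction *)

Section Generation.

Variables (F : fieldType) (T : finType).
Implicit Types (a b s t u : T) (S : {set T}) (c x y z : chain F {set T}).
Implicit Types (k n q : nat) (ty : seq (nat * nat)) (Q : chain F {set T} -> Prop).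

Lemma card_set3 a b s : uniq [:: a; b; s] -> #|[set a; b; s]| = 3%N.
Proof.
move=> /card_uniqP /= <-; apply: eq_card => v.
by rewrite !inE -!orbA.
Qed.

Lemma card_set4 a b s t : uniq [:: a; b; s; t] -> #|[set a; b; s; t]| = 4%N.
Proof.
move=> /card_uniqP /= <-; apply: eq_card => v.
by rewrite !inE -!orbA.
Qed.

Lemma card_set5 a b s t u : uniq [:: a; b; s; t; u] -> #|[set a; b; s; t; u]| = 5%N.
Proof.
move=> /card_uniqP /= <-; apply: eq_card => v.
by rewrite !inE -!orbA.
Qed.

Lemma cycle_in_fan a b s : uniq [:: a; b; s] -> cycle_in [set a; b; s] 1 (fan F a b s).
Proof.
rewrite /= !inE negb_or andbT => /andP[/andP[ab as_] bs].
apply: (@fan_cycle _ _ _ set0 0 a b s); rewrite ?inE ?eqxx ?orbT ?setDv //.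
exact: cycle_in_vac.
Qed.

Lemma wedge_fanE a b s c : wedge (fan F a b s) c = ins [set a; s] c - ins [set a; b] c.
Proof. by rewrite wedgeBl !wedge_ins !wedge_vac. Qed.

Lemma cycle_in_elimination S k Q z : subspace Q ->
  (forall c, boundary_in S k c -> Q c) ->
  (forall k' S1 x c, k = k'.+1 -> S1 \subset S -> #|S1| = 3%N ->
     cycle_in S1 1 x -> cycle_in (S :\: S1) k' c -> Q (wedge x c)) ->
  (forall k' a b s t c, k = k'.+2 -> [set a; b; s; t] \subset S -> uniq [:: a; b; s; t] ->
     cycle_in (S :\: [set a; b; s; t]) k' c -> liftable S k Q a b s t c) ->
  (1 < #|S|)%N -> cycle_in S k z -> Q z.
Proof.
move=> sQ QB Qfan Qlift /card_gt1P[a [b [aS bS nab]]].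
apply: (cycle_elimination sQ QB _ _ aS bS nab).
  move=> k' a' b' s c kE aS' bS' sS' ab as_ bs Zc; rewrite -wedge_fanE.
  have uq : uniq [:: a'; b'; s] by rewrite /= !inE negb_or ab as_ bs.
  apply: Qfan kE _ (card_set3 uq) (cycle_in_fan uq) Zc.
  by rewrite !subUset !sub1set aS' bS' sS'.
move=> k' a' b' s t c kE aS' bS' sS' tS' ab uq Zc; apply: Qlift kE _ uq Zc.
by rewrite !subUset !sub1set aS' bS' sS' tS'.
Qed.

(** Elimination on three vertices: a cofactor lives on the empty set, hence is a scalar, and with
    one edge per face there are no leading terms. *)
Lemma three_cycle_ind S Q z : #|S| = 3%N -> subspace Q ->
  (forall c, boundary_in S 1 c -> Q c) ->
  (forall a b s, S = [set a; b; s] -> uniq [:: a; b; s] -> Q (fan F a b s)) ->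
  cycle_in S 1 z -> Q z.
Proof.
move=> S3 sQ QB Qfan; have /card_gt1P[a [b [aS bS nab]]] : (1 < #|S|)%N by rewrite S3.
apply: (cycle_elimination sQ QB _ _ aS bS nab) => // k' a' b' s c
  [<-] aS' bS' sS' ab as_ bs Zc.
have uq : uniq [:: a'; b'; s] by rewrite /= !inE negb_or ab as_ bs.
rewrite -wedge_fanE (matching_chain0E Zc.1) linearZ /= wedge_vacr.
apply: (subspaceZ _ sQ); apply: (Qfan _ _ _ _ uq); apply/eqP; rewrite eq_sym eqEcard.
by rewrite S3 card_set3 // !subUset !sub1set aS' bS' sS'.
Qed.

Lemma wedge_three_ind S1 S2 Q z1 z2 : #|S1| = 3%N -> #|S2| = 3%N -> [disjoint S1 & S2] ->
  subspace Q -> (forall c, boundary_in (S1 :|: S2) 2 c -> Q c) ->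
  (forall a b s a' b' s', S1 :|: S2 =i [:: a; b; s; a'; b'; s'] ->
     uniq [:: a; b; s; a'; b'; s'] -> Q (wedge (fan F a b s) (fan F a' b' s'))) ->
  cycle_in S1 1 z1 -> cycle_in S2 1 z2 -> Q (wedge z1 z2).
Proof.
move=> c1 c2 dS sQ QB Qfan Z1 Z2.
apply: (three_cycle_ind c1 (wedge_subspacel z2 sQ) _ _ Z1).
  by move=> c Bc; apply: QB; exact: (boundary_in_wedgel dS Bc Z2).
move=> a b s S1E uq1; have Zf := cycle_in_fan uq1; rewrite -S1E in Zf.
apply: (three_cycle_ind c2 (wedge_subspacer _ sQ) _ _ Z2).
  by move=> c Bc; apply: QB; exact: (boundary_in_wedger dS Zf Bc).
move=> a' b' s' S2E uq2; apply: Qfan.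
  by move=> v; rewrite S1E S2E !inE -!orbA.
rewrite (cat_uniq [:: a; b; s]) uq1 uq2 andbT; apply/hasPn => v vE.
have vS2 : v \in S2 by move: vE; rewrite S2E !inE -!orbA.
have := disjointFl dS vS2; rewrite S1E !inE -!orbA => vS1.
by rewrite vS1.
Qed.

Hypothesis three_unit : 3%:R != 0 :> F.

Lemma wedge_three_boundary S1 S2 u z1 z2 : #|S1| = 3%N -> #|S2| = 3%N ->
  [disjoint S1 & S2] -> u \notin S1 :|: S2 -> cycle_in S1 1 z1 -> cycle_in S2 1 z2 ->
  boundary_in (u |: (S1 :|: S2)) 2 (wedge z1 z2).
Proof.
move=> c1 c2 dS uS; apply: wedge_three_ind => //.
- exact: boundary_in_subspace.
- by move=> c; apply: boundary_in_sub; exact: subsetUr.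
- move=> a b s a' b' s' SE uq; apply: (fan_fan_boundary three_unit (u := u)).
    rewrite -[[:: _; _; _; _; _; _; _]]/(rcons [:: a; b; s; a'; b'; s'] u) rcons_uniq uq.
    by rewrite -SE uS.
  move=> v; rewrite -[[:: _; _; _; _; _; _; _]]/(rcons [:: a; b; s; a'; b'; s'] u).
  by rewrite mem_rcons inE -SE => vE; rewrite inE in_set1.
Qed.

Lemma wedge_three_generated S1 S2 z1 z2 : #|S1| = 3%N -> #|S2| = 3%N ->
  [disjoint S1 & S2] -> cycle_in S1 1 z1 -> cycle_in S2 1 z2 ->
  generated (S1 :|: S2) 2 (typed (S1 :|: S2) [:: (1, 0)%N; (5, 2)%N]) (wedge z1 z2).
Proof.
move=> c1 c2 dS; apply: wedge_three_ind => //.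
- exact: generated_subspace.
- by move=> c; exact: generated_boundary.
have cS : #|S1 :|: S2| = 6%N by rewrite cardsU (disjoint_setI0 dS) cards0 c1 c2.
move=> a b s a' b' s' SE uq.
apply: (fan_fan_pentagons three_unit (S := S1 :|: S2) (generated_subspace _ _ _)) => //.
- by move=> x; exact: generated_boundary.
- move=> p q r t w o uqp sub; apply: generated_typed => //.
  have oS : o \in S1 :|: S2 by apply: sub; rewrite !inE eqxx !orbT.
  have sub5 : [set p; q; r; t; w] \subset S1 :|: S2.
    by apply/subsetP => v vE; apply: sub; move: vE;
      rewrite !inE -!orbA => /or4P[-> | -> | -> | /orP[]->]; rewrite ?orbT.
  have [uq5 o5] : uniq [:: p; q; r; t; w] /\ o \notin [:: p; q; r; t; w].
    by move: uqp; rewrite -[[:: _; _; _; _; _; _]]/(rcons [:: p; q; r; t;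
      w] o) rcons_uniq => /andP[].
  (* By counting, the pentagon fills all six vertices but o. *)
  have E : (S1 :|: S2) :\ o = [set p; q; r; t; w].
    apply/eqP; rewrite eq_sym eqEcard subsetD1 sub5 card_set5 //.
    move: cS; rewrite (cardsD1 o) oS add1n => -[->]; rewrite andbT.
    by move: o5; rewrite !inE -!orbA.
  exists [set o], (vac F _), (pentagon F p q r t w); split.
  + by rewrite sub1set.
  + exact: cards1.
  + exact: cycle_in_vac.
  + exists [set p; q; r; t; w], (pentagon F p q r t w), (vac F _).
    rewrite E setDv wedge_vacr; split=> //; last exact: pentagon_cycle.
    exact: card_set5.
  + by rewrite wedge_vac.
- by move=> v; rewrite SE.
Qed.

Lemma cycle_typed S n k c : #|S| = n -> cycle_in S k c -> typed S [:: (n, k)] c.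
Proof. by move=> cS Zc; exists S, c, (vac F _); rewrite setDv wedge_vacr. Qed.

Lemma typed_wedge S S1 n k ty x c : S1 \subset S -> #|S1| = n -> cycle_in S1 k x ->
  typed (S :\: S1) ty c -> typed S ((n, k) :: ty) (wedge x c).
Proof. by move=> sS cS Zx ty_c; exists S1, x, c. Qed.

Lemma generated_wedge S S1 n k k1 k2 ty x c : S1 \subset S -> #|S1| = n ->
  cycle_in S1 k1 x -> k = (k1 + k2)%N -> k2 = type_dim ty ->
  generated (S :\: S1) k2 (typed (S :\: S1) ty) c ->
  generated S k (typed S ((n, k1) :: ty)) (wedge x c).
Proof.
move=> sS cS Zx kE dE Gc.
apply: (generated_wedger (esym (setUDS sS)) kE (disjointsD _ _) Zx Gc) => y _ ty_y.
apply: generated_typed; first by rewrite kE dE.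
exact: (typed_wedge sS cS Zx ty_y).
Qed.

Lemma generated_swap S k p1 p2 ty c : generated S k (typed S (p1 :: p2 :: ty)) c ->
  generated S k (typed S (p2 :: p1 :: ty)) c.
Proof.
move=> G; apply: (generated_sub G) => x Zx ty_x.
by apply: (generated_mem Zx); exact: typed_swap.
Qed.

Lemma generated_33 S k ty c : k = (2 + type_dim ty)%N ->
  typed S [:: (3, 1)%N, (3, 1)%N & ty] c -> generated S k
    (typed S [:: (1, 0)%N, (5, 2)%N & ty]) c.
Proof.
move=> kE; apply: (@generated_typed_head _ _ _ _ [:: (3, 1)%N; (3, 1)%N] [:: (1, 0)%N;
  (5, 2)%N]) => //.
move=> S' x _ [S1 [x1 [y1 [sS1 c1 Z1 [S2 [x2 [y2 [sS2 c2 Z2 [S0 ->] ->]]]] ->]]]].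
have S2E : S2 = S' :\: S1.
  by apply/eqP; rewrite eqEsubset sS2 -setD_eq0 S0 eqxx.
rewrite wedge_vacr -(setUDS sS1) -S2E; apply: wedge_three_generated => //.
by rewrite S2E disjointsD.
Qed.

Lemma type_dim_52 q : type_dim (nseq q (5, 2)%N) = (2 * q)%N.
Proof. by rewrite /type_dim map_nseq sumn_nseq. Qed.

(** With d = k - 1 the inequality is exactly 5d < 2n - 8. *)
Definition vanishes S := forall k c, (5 * k + 4 <= 2 * #|S|)%N ->
  cycle_in S k c -> boundary_in S k c.

(** Writing q = r + 1 expresses 5q - 3 and 2q - 1 without truncated subtraction. *)
Definition generated0 S := forall q c, #|S| = (5 * q)%N -> cycle_in S (2 * q) c ->
  generated S (2 * q) (fun x => typed S (nseq q (5, 2)%N) x \/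
    exists2 r, q = r.+1 & typed S [:: (3, 1)%N; (5 * r + 2, 2 * r + 1)%N] x) c.

Definition generated1 S := forall q c, #|S| = (5 * q + 1)%N -> cycle_in S (2 * q) c ->
  generated S (2 * q) (typed S ((1, 0)%N :: nseq q (5, 2)%N)) c.

Definition generated3 S := forall q c, #|S| = (5 * q + 3)%N -> cycle_in S (2 * q + 1) c ->
  generated S (2 * q + 1) (typed S ((3, 1)%N :: nseq q (5, 2)%N)) c.

Definition generated4 S := forall q c, #|S| = (5 * q + 4)%N -> cycle_in S (2 * q + 1) c ->
  generated S (2 * q + 1) (typed S [:: (1, 0)%N, (3, 1)%N & nseq q (5, 2)%N]) c.

(** * The induction step for each of the five statements *)

Section Step.

Variable S : {set T}.

Hypothesis vanishes_lt : forall S', (#|S'| < #|S|)%N -> vanishes S'.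

(** The bound 5k + 2 <= 2n is the vanishing range for n - 4 vertices and k - 2 edges, so the
    coefficient of a leading term is a boundary. *)
Lemma liftable_vanishing k k' Q a b s t c : subspace Q ->
  (forall c, boundary_in S k c -> Q c) -> k = k'.+2 ->
  [set a; b; s; t] \subset S -> uniq [:: a; b; s; t] -> (5 * k + 2 <= 2 * #|S|)%N ->
  cycle_in (S :\: [set a; b; s; t]) k' c -> liftable S k Q a b s t c.
Proof.
move=> sQ QB kE sub uq le Zc; rewrite kE in QB *.
have cS := cardsDS sub; rewrite card_set4 // in cS.
have le4 := subset_leq_card sub; rewrite card_set4 // in le4.
apply: liftable_boundary => //; apply: vanishes_lt Zc; rewrite cS; lia.
Qed.

Lemma vanishes_step : (forall S', (#|S'| < #|S|)%N -> generated4 S') -> vanishes S.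
Proof.
move=> IH k z le; have sB := boundary_in_subspace F S k.
apply: (cycle_in_elimination sB) => //; last by lia.
- move=> k' S1 x c kE sS1 c1 Zx Zc.
  have cS := cardsDS sS1; rewrite c1 in cS.
  have le3 := subset_leq_card sS1; rewrite c1 in le3.
  rewrite -(setUDS sS1) kE -add1n.
  (* Vanishing for the cofactor amounts to 5k + 5 <= 2n. It fails only if 2n = 5k + 4; then k is
     even and the cofactor lies on 5r + 4 vertices with 2r + 1 edges per face. *)
  have [le'|gt] := leqP (5 * k' + 4)%N (2 * #|S :\: S1|)%N.
    apply: (boundary_in_wedger (disjointsD _ _) Zx); apply: vanishes_lt Zc => //.
    by rewrite cS; lia.
  pose r := k'./2.
  have k'E : k' = (2 * r + 1)%N by rewrite /r; lia.
  have := IH (S :\: S1) _ r c _ _; rewrite -k'E => /(_ _ _ Zc) G.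
  apply: (generated_ind (wedge_subspacer x (boundary_in_subspace F _ _)) _ _ (G _ _)).
  + by move=> y; exact: boundary_in_wedger (disjointsD _ _) Zx.
  + move=> _ _ [S0 [x0 [_ [sS0 c0 Z0 [S2 [x2 [y [sS2 c2 Z2 /typed_cycle Zy ->]]]] ->]]]].
    rewrite (matching_chain0E Z0.1) wedgeZl wedge_vac linearZ /=.
    apply: (subspaceZ _ (boundary_in_subspace F _ _)).
    rewrite wedgeA setUDS //.
    have /cards1P[u uE] : #|S0| == 1 by rewrite c0.
    subst S0; move: sS0; rewrite sub1set inE => /andP[uS1 uS].
    move: sS2; rewrite !subsetD => /andP[/andP[sS2 d12] uS2].
    (* The point u of the block [1,0] is the seventh vertex beside the two triples. *)
    have B : boundary_in (u |: (S1 :|: S2)) 2 (wedge x x2).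
      apply: wedge_three_boundary => //; first by rewrite disjoint_sym.
      by rewrite inE negb_or uS1; move: uS2; rewrite disjoint_sym disjoints1.
    have sub : (u |: (S1 :|: S2)) :|: (S :\: S1 :\: [set u] :\: S2) \subset S.
      by rewrite !subUset sub1set uS sS1 sS2 !setDDl subsetDl.
    apply: (boundary_in_sub sub).
    rewrite (_ : 1 + k' = 2 + type_dim (nseq r (5, 2)%N))%N;
      last by rewrite type_dim_52 k'E; lia.
    apply: boundary_in_wedgel B Zy; rewrite -setI_eq0; apply/eqP/setP => v.
    by rewrite !inE; do ?case: (_ \in _) => //=; rewrite ?andbF //; case: eqP.
  + by rewrite cS; lia.
  + by rewrite cS; lia.
- by move=> k' a b s t c kE sub uq; apply: liftable_vanishing => //; lia.
Qed.

(** With q = r + 1, a product with a fan is of the second kind as it stands, and the coefficients of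
    leading terms lie on 5r + 1 vertices, where (ii) provides a free vertex for the pentagon. *)
Lemma generated0_step : (forall S', (#|S'| < #|S|)%N -> generated1 S') -> generated0 S.
Proof.
move=> IH [|r] z cS Zz.
  have S0 : S = set0 by apply/eqP; rewrite -cards_eq0 cS.
  rewrite muln0 in Zz *; rewrite (matching_chain0E Zz.1).
  apply: (subspaceZ _ (generated_subspace _ _ _)); apply: generated_mem.
    exact: cycle_in_vac.
  by left.
move: Zz; set P := fun x => _ \/ _.
apply: (cycle_in_elimination (generated_subspace S (2 * r.+1) P)) => //; last by lia.
- by move=> c; exact: generated_boundary.
- move=> k' S1 x c kE sS1 c1 Zx Zc.
  have cD := cardsDS sS1; rewrite c1 in cD.
  have {}kE : k' = (2 * r + 1)%N by lia.
  have ty_xc : typed S [:: (3, 1)%N; (5 * r + 2, 2 * r + 1)%N] (wedge x c).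
    rewrite kE in Zc; apply: (typed_wedge sS1 c1 Zx).
    by apply: (cycle_typed _ Zc); rewrite cD; lia.
  apply: generated_mem; last by right; exists r.
  have := typed_cycle ty_xc; rewrite /type_dim /=.
  by rewrite (_ : 1 + (2 * r + 1 + 0) = 2 * r.+1)%N //; lia.
- move=> k' a b s t c kE sub uq Zc.
  have cD := cardsDS sub; rewrite card_set4 // in cD.
  have {}kE : k' = (2 * r)%N by lia.
  rewrite (_ : 2 * r.+1 = k'.+2)%N in P *; last by lia.
  apply: (@liftable_generated _ _ _ _ _ _ _ _ _ (nseq r (5, 2)%N)) => //.
  + exact: generated_subspace.
  + by move=> x; exact: generated_boundary.
  + move=> x ty_x; apply: generated_mem; last by left.
    have := typed_cycle ty_x; rewrite /type_dim /= -/(type_dim _) type_dim_52.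
    by rewrite kE.
  + by rewrite type_dim_52.
  + by rewrite kE in Zc *; apply: IH => //; rewrite cD; lia.
Qed.

(** By (iii) on 5r + 3 vertices the fans give [3,1] /\ [3,1] /\ [5,2]^r, and two triples are traded
    for [1,0] /\ [5,2]; leading terms lift by vanishing. *)
Lemma generated1_step : (forall S', (#|S'| < #|S|)%N -> generated3 S') -> generated1 S.
Proof.
move=> IH [|r] z cS Zz.
  rewrite muln0 in Zz *; apply: generated_typed => //.
  exact: (cycle_typed cS Zz).
move: Zz; set P := typed S _.
apply: (cycle_in_elimination (generated_subspace S (2 * r.+1) P)) => //; last by lia.
- by move=> c; exact: generated_boundary.
- move=> k' S1 x c kE sS1 c1 Zx Zc.
  have cD := cardsDS sS1; rewrite c1 in cD.
  have {}kE : k' = (2 * r + 1)%N by lia.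
  rewrite kE in Zc.
  have G : generated S (2 * r.+1) (typed S [:: (3, 1)%N, (3, 1)%N & nseq r (5, 2)%N])
    (wedge x c).
    apply: (generated_wedge sS1 c1 Zx (k2 := 2 * r + 1)); first by lia.
      by rewrite /type_dim /= -/(type_dim _) type_dim_52; lia.
    by apply: IH => //; rewrite cD; lia.
  apply: (generated_sub G) => y _; apply: generated_33.
  by rewrite type_dim_52; lia.
- move=> k' a b s t c kE sub uq; apply: liftable_vanishing => //.
  + exact: generated_subspace.
  + by move=> x; exact: generated_boundary.
  + by lia.
Qed.

(** The fan cofactors lie on 5r + 1 vertices, so (ii) gives the type up to order; leading terms lift
    by vanishing. *)
Lemma generated4_step : (forall S', (#|S'| < #|S|)%N -> generated1 S') -> generated4 S.
Proof.
move=> IH r z cS; set P := typed S _.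
apply: (cycle_in_elimination (generated_subspace S (2 * r + 1) P)) => //; last by lia.
- by move=> c; exact: generated_boundary.
- move=> k' S1 x c kE sS1 c1 Zx Zc.
  have cD := cardsDS sS1; rewrite c1 in cD.
  have {}kE : k' = (2 * r)%N by lia.
  rewrite kE in Zc.
  apply: generated_swap; apply: (generated_wedge sS1 c1 Zx (k2 := 2 * r)); first by lia.
    by rewrite /type_dim /= -/(type_dim _) type_dim_52; lia.
  by apply: IH => //; rewrite cD; lia.
- move=> k' a b s t c kE sub uq; apply: liftable_vanishing => //.
  + exact: generated_subspace.
  + by move=> x; exact: generated_boundary.
  + by lia.
Qed.

(** The delicate case is a fan times the second kind of cycle in (i): it has two triples and an
    uncontrolled block. Trading the triples for [1,0] /\ [5,2] leaves, beside the pentagon block, a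
    cycle to which (iii) applies inductively. *)
Lemma generated3_step :
  (forall S', (#|S'| < #|S|)%N -> [/\ generated0 S', generated3 S' & generated4 S']) ->
  generated3 S.
Proof.
move=> IH [|r] z cS Zz.
  rewrite muln0 add0n in Zz *; apply: generated_typed => //.
  exact: (cycle_typed cS Zz).
move: Zz; set P := typed S _.
apply: (cycle_in_elimination (generated_subspace S (2 * r.+1 + 1) P)) => //; last by lia.
- by move=> c; exact: generated_boundary.
- move=> k' S1 x c kE sS1 c1 Zx Zc.
  have cD := cardsDS sS1; rewrite c1 in cD.
  have {}kE : k' = (2 * r.+1)%N by lia.
  rewrite kE in Zc.
  have [G0 _ _] : [/\ generated0 (S :\: S1), generated3 (S :\: S1) & generated4 (S :\: S1)].
    by apply: IH; rewrite cD; lia.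
  have k2E : (2 * r.+1 + 1 = 1 + 2 * r.+1)%N by lia.
  have cD5 : #|S :\: S1| = (5 * r.+1)%N by rewrite cD; lia.
  apply: (generated_wedger (esym (setUDS sS1)) k2E (disjointsD _ _) Zx (G0 _ _ cD5 Zc)).
  move=> y _ [ty_y|[_ [<-] ty_y]].
    apply: generated_typed; last exact: (typed_wedge sS1 c1 Zx ty_y).
    by rewrite /type_dim /= -/(type_dim _) type_dim_52; lia.
  have G : generated S (2 * r.+1 + 1)
      (typed S [:: (1, 0)%N; (5, 2)%N; (5 * r + 2, 2 * r + 1)%N]) (wedge x y).
    apply: generated_33; first by rewrite /type_dim /=; lia.
    exact: (typed_wedge sS1 c1 Zx ty_y).
  apply: (generated_sub (generated_swap G)) => w _.
  move=> [S5 [x5 [y5 [sS5 c5 Z5 ty5 ->]]]].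
  have cD' := cardsDS sS5; rewrite c5 in cD'.
  (* The blocks [1,0] and [5r+2, 2r+1] are merged into one cycle on 5r + 3 vertices with 2r + 1
     edges per face. *)
  have := @typed_cycle _ _ _ [:: (1, 0); (5 * r + 2, 2 * r + 1)]%N _ ty5.
  rewrite /type_dim /= add0n addn0 => Zy5.
  have [_ G3 _] : [/\ generated0 (S :\: S5), generated3 (S :\: S5) & generated4 (S :\: S5)].
    by apply: IH; rewrite cD'; lia.
  rewrite /P -[nseq r.+1 _]/((5, 2)%N :: nseq r (5, 2)%N); apply: generated_swap.
  apply: (generated_wedge sS5 c5 Z5 (k2 := 2 * r + 1)); first by lia.
    by rewrite /type_dim /= -/(type_dim _) type_dim_52; lia.
  by apply: G3 => //; rewrite cD'; lia.
- move=> k' a b s t c kE sub uq Zc.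
  have cD := cardsDS sub; rewrite card_set4 // in cD.
  have {}kE : k' = (2 * r + 1)%N by lia.
  rewrite (_ : 2 * r.+1 + 1 = k'.+2)%N; last by lia.
  apply: (@liftable_generated _ _ _ _ _ _ _ _ _ ((3, 1)%N :: nseq r (5, 2)%N)) => //.
  + exact: generated_subspace.
  + by move=> x; exact: generated_boundary.
  + move=> x ty_x; rewrite /P -[nseq r.+1 _]/((5, 2)%N :: nseq r (5, 2)%N).
    apply: generated_swap; apply: generated_typed => //.
    by rewrite /type_dim /= -/(type_dim _) type_dim_52; lia.
  + by rewrite /type_dim /= -/(type_dim _) type_dim_52; lia.
  + have [_ _ G4] : [/\ generated0 (S :\: [set a; b; s; t]),
        generated3 (S :\: [set a; b; s; t]) & generated4 (S :\: [set a; b; s; t])].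
      by apply: IH; rewrite cD; lia.
    by rewrite kE in Zc *; apply: G4 => //; rewrite cD; lia.
Qed.

End Step.

Theorem bottom_cycles S :
  [/\ vanishes S, generated0 S, generated1 S, generated3 S & generated4 S].
Proof.
have [n le_n] := ubnP #|S|; elim: n S le_n => // n IH S /ltnSE le_n.
have {}IH S' : (#|S'| < #|S|)%N ->
    [/\ vanishes S', generated0 S', generated1 S', generated3 S' & generated4 S'].
  by move=> lt_S; apply: IH; exact: leq_trans lt_S le_n.
have V S' : (#|S'| < #|S|)%N -> vanishes S' by move=> /IH[].
split.
- by apply: vanishes_step => // S' /IH[].
- by apply: generated0_step => S' /IH[].
- by apply: generated1_step => // S' /IH[].
- by apply: generated3_step => S' /IH[].
- by apply: generated4_step => // S' /IH[].
Qed.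

End Generation.

(** * Homology classes *)

Section Homology.

Variables (F : fieldType) (T : finType).
Implicit Types (S : {set T}) (k : nat) (d : int) (c : chain F {set T}).

Lemma span_subspace (W : vectType F) (X : seq W) (Q : W -> Prop) x : subspace Q ->
  (forall y, y \in X -> Q y) -> x \in <<X>>%VS -> Q x.
Proof.
move=> sQ QX /(@coord_span _ _ _ (in_tuple X)) ->.
apply: (subspace_sum _ sQ) => i _; apply: (subspaceZ _ sQ); apply: QX.
exact: mem_nth.
Qed.

Lemma mem_chains S d c : c \in chains F (matching_complex S) d <->
  forall m, c m != 0 -> m \in matching_complex S /\ #|m|%:Z = d + 1.
Proof.
split=> [|Cc].
  apply: (@span_subspace _ _ (fun c => forall m, c m != 0 -> m \in _ /\ #|m|%:Z = d + 1)).
    split=> [m|a x y Cx Cy m]; rewrite !ffunE ?eqxx //.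
    have [->|nz _] := eqVneq (x m) 0; last exact: Cx.
    by rewrite scaler0 add0r; exact: Cy.
  move=> _ /imageP[s sK ->] m; rewrite osimp_enumE.
  have [->|_] := eqVneq m s; last by rewrite eqxx.
  by move: sK; rewrite inE => /andP[-> /eqP].
rewrite (chain_decomp c); apply: rpred_sum => m _.
have [->|/Cc[mS mk]] := eqVneq (c m) 0; first by rewrite scale0r rpred0.
apply: rpredZ; apply: memv_span; apply/imageP; exists m => //.
by rewrite inE mS mk eqxx.
Qed.

Lemma mem_cycles S k c :
  c \in cycles F (matching_complex S) (k%:Z - 1) <-> cycle_in S k c.
Proof.
rewrite memv_cap memv_ker lfunE /=; split=> [/andP[/mem_chains Cc /eqP dc]|[Cc dc]].
  by split=> // m /Cc[-> /eqP]; rewrite subrK => /eqP[->].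
rewrite dc eqxx andbT; apply/mem_chains => m /Cc[-> ->].
by rewrite subrK.
Qed.

Lemma mem_boundaries S k c : boundary_in S k c ->
  c \in boundaries F (matching_complex S) (k%:Z - 1).
Proof.
move=> [b Cb ->]; rewrite -[boundary b](lfunE (@boundary F _)); apply: memv_img.
apply/mem_chains => m /Cb[-> ->]; split=> //.
by rewrite subrK -addn1 PoszD.
Qed.

Section Classes.

Variables (K : {set {set {set T}}}) (d : int).

Local Notation hclass := (@hclass F {set T} K d).

Lemma hclassD z z' : hclass (z + z') = hclass z + hclass z'.
Proof. exact: raddfD. Qed.

Lemma hclassMn z n : hclass (z *+ n) = hclass z *+ n.
Proof. exact: raddfMn. Qed.

Lemma hclass_eq0 z : vsval z \in boundaries F K d -> hclass z = 0.
Proof.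
move=> Bz; rewrite -[RHS](raddf0 (\pi_(Quotient.quot _))%qT).
apply/eqmodP; rewrite /= Quotient.equivE subr0 /boundaries_in_cycles.
by rewrite -memv_preim lfunE.
Qed.

Lemma hclass_repr (x : homology F K d) : exists z, x = hclass z.
Proof. by exists (repr x); rewrite /Defs.hclass reprK. Qed.

End Classes.

Lemma homology_vanishes S k : (forall c, cycle_in S k c -> boundary_in S k c) ->
  forall x : homology F (matching_complex S) (k%:Z - 1), x = 0.
Proof.
move=> V x; have [z ->] := hclass_repr x; apply: hclass_eq0.
by apply: mem_boundaries; apply: V; apply/mem_cycles; exact: subvsP.
Qed.

(** Degrees below -1 are not of the form k - 1 with k natural; there a face would have negative
    cardinality. *)
Lemma homology_below S d : d < -1 ->
  forall x : homology F (matching_complex S) d, x = 0.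
Proof.
move=> lt_d x; have [z ->] := hclass_repr x; apply: hclass_eq0.
have /memv_capP[/mem_chains Cz _] := subvsP z.
suff -> : vsval z = 0 by rewrite rpred0.
apply/ffunP => m; rewrite [RHS]ffunE; apply/eqP; apply: contraTT lt_d => /Cz[_].
lia.
Qed.

End Homology.

(** Homology is to be generated as a group, with integer coefficients; over the prime field every
    scalar is the class of an integer, so the linear span suffices. *)
Lemma homology_generated p (T : finType) (S : {set T}) k
    (P P' : chain 'F_p {set T} -> Prop) : prime p ->
  (forall c, cycle_in S k c -> generated S k P c) ->
  (forall c, cycle_in S k c -> P c -> P' c) ->
  homology_generated_by (matching_complex S) (k%:Z - 1) P'.
Proof.
move=> p_prime G PP' x; have [z ->] := hclass_repr x.
pose Q c := exists z' : subvs_of (cycles 'F_p (matching_complex S) (k%:Z - 1)),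
  vsval z' = c /\ exists2 w : seq (int * subvs_of (cycles 'F_p (matching_complex S) (k%:Z - 1))),
      forall u, u \in w -> P' (vsval u.2)
      & hclass z' = \sum_(u <- w) hclass u.2 *~ u.1.
have sQ : subspace Q.
  split.
    exists 0; split; first exact: raddf0.
    by exists [::] => //; rewrite big_nil hclass_eq0 // raddf0 rpred0.
  move=> a _ _ [z1 [<- [w1 Pw1 e1]]] [z2 [<- [w2 Pw2 e2]]].
  exists (a *: z1 + z2); split; first by rewrite linearP.
  exists ([seq (u.1 * (a : nat)%:Z, u.2) | u <- w1] ++ w2).
    by move=> u; rewrite mem_cat => /orP[/mapP[u' /Pw1 ? ->]|/Pw2].
  rewrite hclassD big_cat big_map /= -e2; congr (_ + _).
  (* The scalar is replaced by its representative in the natural numbers. *)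
  rewrite -[a in LHS]natr_Zp scaler_nat hclassMn e1 -sumrMnl.
  by apply: eq_bigr => u _; rewrite mulrzA pmulrn.
have [z' [zE [w Pw e]]] : Q (vsval z).
  apply: (generated_ind sQ _ _ (G _ _)).
  - move=> c Bc; have Zc : c \in cycles 'F_p (matching_complex S) (k%:Z - 1).
      by apply/mem_cycles; exact: boundary_in_cycle.
    exists (vsproj _ c); split; first exact: vsprojK.
    exists [::] => //; rewrite big_nil; apply: hclass_eq0.
    by rewrite vsprojK //; exact: mem_boundaries.
  - move=> c Zc Pc; exists (vsproj _ c).
    have cZ : c \in cycles 'F_p (matching_complex S) (k%:Z - 1) by apply/mem_cycles.
    split; first exact: vsprojK.
    exists [:: (1, vsproj _ c)] => [u|]; last by rewrite big_seq1.
    by rewrite inE => /eqP-> /=; rewrite vsprojK //; exact: PP'.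
  - by apply/mem_cycles; exact: subvsP.
by exists w => //; rewrite -e; congr hclass; apply: val_inj.
Qed.

Lemma typed_of_type (F : fieldType) n (ty : seq (nat * nat)) (c : chain F {set 'I_n}) :
  typed [set: 'I_n] ty c -> of_type [seq (r.1%:Z, r.2%:Z) | r <- ty] c.
Proof.
rewrite /of_type; move: [set: 'I_n] => U.
elim: ty U c => [|[m k] ty IH] U c /=.
  move=> [-> ->]; exists (fun=> set0), (fun=> 0).
  by split; [case | exact: big_ord0 | case | case | apply/esym; exact: big_ord0].
move=> [S1 [x [y [sS1 c1 Zx /IH[S [z [dS US cS Zz ->]]] ->]]]].
(* Index 0 is the block just peeled off; [unlift] shifts the other indices to the remaining type. *)
exists (fun i => if unlift ord0 i is Some j then S j else S1).
exists (fun i => if unlift ord0 i is Some j then z j else x).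
have sS j : [disjoint S1 & S j].
  by apply: (disjointWr _ (disjointsD U S1)); rewrite -US; exact: (bigcup_sup j).
split.
- move=> i j; case: (unliftP ord0 i) => [i'|] ->; case: (unliftP ord0 j) => [j'|] -> //.
  + by rewrite (inj_eq lift_inj) => /dS.
  + by rewrite disjoint_sym.
- rewrite big_ord_recl unlift_none; under eq_bigr do rewrite liftK.
  by rewrite US setUDS.
- move=> i; case: (unliftP ord0 i) => [j|] ->.
    by rewrite cS !(tnth_nth (0, 0)).
  by rewrite c1 (tnth_nth (0, 0)).
- move=> i; case: (unliftP ord0 i) => [j|] ->.
    by have := Zz j; rewrite !(tnth_nth (0, 0)).
  by rewrite (tnth_nth (0, 0)); apply/mem_cycles.
- rewrite big_ord_recl unlift_none; congr wedge.
  by apply: eq_bigr => j _; rewrite liftK.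
Qed.

Theorem theorem5p8 (p : nat) (p_prime : prime p) (p_neq3 : p <> 3%N) :
  (forall (n : nat) (d : int),
     ~ (2 * n%:Z - 8 <= 5 * d) -> forall x : homology 'F_p (M n) d, x = 0) /\
  (forall q : nat,
     [/\ @homology_generated_by 'F_p _ (M (5 * q)) (2 * q%:Z - 1)
           (fun c => of_type (nseq q (5, 2)) c \/
                     of_type [:: (3, 1); (5 * q%:Z - 3, 2 * q%:Z - 1)] c),
         @homology_generated_by 'F_p _ (M (5 * q + 1)) (2 * q%:Z - 1)
           (of_type ((1, 0) :: nseq q (5, 2))),
         @homology_generated_by 'F_p _ (M (5 * q + 3)) (2 * q%:Z)
           (of_type ((3, 1) :: nseq q (5, 2)))
       & @homology_generated_by 'F_p _ (M (5 * q + 4)) (2 * q%:Z)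
           (of_type [:: (1, 0), (3, 1) & nseq q (5, 2)])]).
Proof.
have three_unit : 3%:R != 0 :> 'F_p.
  rewrite -(dvdn_pcharf (pchar_Fp p_prime)) dvdn_prime2 //.
  exact/eqP.
split=> [n d gt x|q].
  have [lt_d|ge_d] : d < -1 \/ -1 <= d by lia.
    exact: (homology_below lt_d x).
  have [k kE] : exists k : nat, d = k%:Z - 1 by exists (absz (d + 1)); lia.
  subst d; apply: (homology_vanishes _ x).
  have [V _ _ _ _] := bottom_cycles three_unit [set: 'I_n].
  by move=> c; apply: V; rewrite cardsT card_ord; lia.
have ty52 : [seq (r.1%:Z, r.2%:Z) | r <- nseq q (5, 2)%N] = nseq q (5, 2).
  by rewrite map_nseq.
have e1 : 2 * q%:Z - 1 = (2 * q)%N%:Z - 1 by lia.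
(* A face of dimension 2q has 2q + 1 edges. *)
have e2 : 2 * q%:Z = (2 * q + 1)%N%:Z - 1 by lia.
have card_I m : #|[set: 'I_m]| = m by rewrite cardsT card_ord.
split.
- have [_ G _ _ _] := bottom_cycles three_unit [set: 'I_(5 * q)].
  rewrite e1; apply: (homology_generated p_prime (fun c => G q c (card_I _))).
  move=> c _ [/typed_of_type|[r qE /typed_of_type]]; first by rewrite ty52; left.
  by rewrite /= (_ : (5 * r + 2)%N%:Z = 5 * q%:Z - 3) 1?(_ : (2 * r + 1)%N%:Z = (2 * q)%N%:Z - 1); [right | lia | lia].
- have [_ _ G _ _] := bottom_cycles three_unit [set: 'I_(5 * q + 1)].
  rewrite e1; apply: (homology_generated p_prime (fun c => G q c (card_I _))).
  by move=> c _ /typed_of_type; rewrite /= ty52.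
- have [_ _ _ G _] := bottom_cycles three_unit [set: 'I_(5 * q + 3)].
  rewrite e2; apply: (homology_generated p_prime (fun c => G q c (card_I _))).
  by move=> c _ /typed_of_type; rewrite /= ty52.
- have [_ _ _ _ G] := bottom_cycles three_unit [set: 'I_(5 * q + 4)].
  rewrite e2; apply: (homology_generated p_prime (fun c => G q c (card_I _))).
  by move=> c _ /typed_of_type; rewrite /= ty52.
Qed.
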